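(* Fix an admissible triple $(p_0,q_0,r_0)$ with $q_0\in(1,\infty]$. Then there exists a nondoubling metric measure space $\mathfrak Z$ such that $\mathfrak c(p_0,1,r_0,\mathfrak Z)<\infty$ and $\mathfrak c(p_0,q_0,r_0,\mathfrak Z)=\infty$.
   Context: Metric measure space $(X,\rho,\mu)$: nonempty set, metric, nonnegative Borel measure, every open ball of positive finite measure; doubling means $\mu(B(x,2s))\le C\mu(B(x,s))$ uniformly. Lorentz quasinorm: $d_f(t)=\mu(\{|f|>t\})$, $\|f\|_{p,q}=p^{1/q}(\int_0^\infty(t d_f(t)^{1/p})^q dt/t)^{1/q}$ for $q<\infty$, $\|f\|_{p,\infty}=\sup_{t>0}t d_f(t)^{1/p}$. $\mathcal M^{\rm c}_{\mathfrak X}f(x)=\sup_{s>0}\mu(B(x,s))^{-1}\int_{B(x,s)}|f|d\mu$. $\mathfrak c(p,q,r,\mathfrak X)$ is the smallest $c$ with $\|\mathcal M^{\rm c}_{\mathfrak X}f\|_{p,r}\le c\|f\|_{p,q}$ for all $f\in L^{p,q}(\mathfrak X)$ ($\infty$ if none). A triple $(p,q,r)$ is admissible if either $p=q=1$ and $r\in[1,\infty]$, or $p\in(1,\infty)$ and $q,r\in[1,\infty]$ with $q\le r$. *)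

(* Defs.v *)
From HB Require Import structures.
From mathcomp Require Import all_boot all_order all_algebra.
From mathcomp Require Import all_classical all_reals all_analysis.
Set Implicit Arguments. Unset Strict Implicit. Unset Printing Implicit Defensive.
Import Order.TTheory GRing.Theory Num.Theory.
Local Open Scope classical_set_scope.
Local Open Scope ring_scope.

Section Defs.
Context {R : realType} {d : measure_display} {T : measurableType d}.

Definition is_metric (rho : T -> T -> R) : Prop :=
  [/\ forall x y, 0 <= rho x y,
      forall x y, rho x y = 0 <-> x = y,
      forall x y, rho x y = rho y x &
      forall x y z, rho x z <= rho x y + rho y z].

Definition mball (rho : T -> T -> R) (x : T) (s : R) : set T :=
  [set y | rho x y < s].

Definition mopen (rho : T -> T -> R) : set (set T) :=
  [set A | forall x, A x -> exists e : R, 0 < e /\ mball rho x e `<=` A].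

Definition metric_measure_space (rho : T -> T -> R)
    (mu : {measure set T -> \bar R}) : Prop :=
  [/\ inhabited T,
      is_metric rho,
      @measurable d T = <<s mopen rho >> &
      forall x s, 0 < s -> (0 < mu (mball rho x s) < +oo)%E].

Definition doubling (rho : T -> T -> R) (mu : {measure set T -> \bar R}) : Prop :=
  exists C : R, forall x s, 0 < s ->
    (mu (mball rho x (2 * s)) <= C%:E * mu (mball rho x s))%E.

(* outer measure induced by mu (coincides with mu on measurable sets) *)
Definition outer_mu (mu : {measure set T -> \bar R}) (A : set T) : \bar R :=
  ereal_inf [set mu B | B in [set B | measurable B /\ A `<=` B]].

(* distribution function d_f(t) = mu({|f| > t}) for f : T -> [0, +oo] *)
Definition distrib (mu : {measure set T -> \bar R}) (f : T -> \bar R) (t : R)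
  : \bar R := outer_mu mu [set x | (t%:E < f x)%E].

Definition lorentz (mu : {measure set T -> \bar R}) (p : R) (q : \bar R)
    (f : T -> \bar R) : \bar R :=
  match q with
  | q'%:E =>
      ((p `^ q'^-1)%:E *
       poweR (\int[lebesgue_measure]_(t in (`]0%R, +oo[%classic : set R))
                ((poweR (t%:E * poweR (distrib mu f t) p^-1) q') * (t^-1)%:E))
             q'^-1)%E
  | +oo%E => ereal_sup [set (t%:E * poweR (distrib mu f t) p^-1)%E
                         | t in [set t : R | 0 < t]]
  | -oo%E => +oo%E (* irrelevant: q >= 1 throughout *)
  end.

Definition absE (f : T -> R) : T -> \bar R := fun x => (`|f x|)%:E.

Definition in_lorentz (mu : {measure set T -> \bar R}) (p : R) (q : \bar R)
    (f : T -> R) : Prop :=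
  measurable_fun [set: T] f /\ (lorentz mu p q (absE f) < +oo)%E.

Definition maxfun (rho : T -> T -> R) (mu : {measure set T -> \bar R})
    (f : T -> R) (x : T) : \bar R :=
  ereal_sup [set ((fine (mu (mball rho x s)))^-1%:E *
                  \int[mu]_(y in mball rho x s) (`|f y|)%:E)%E
            | s in [set s : R | 0 < s]].

Definition maxconst (rho : T -> T -> R) (mu : {measure set T -> \bar R})
    (p : R) (q r : \bar R) : \bar R :=
  ereal_inf [set c%:E | c in [set c : R | 0 <= c /\
     forall f : T -> R, in_lorentz mu p q f ->
       (lorentz mu p r (maxfun rho mu f) <= c%:E * lorentz mu p q (absE f))%E]].

End Defs.

Definition admissible {R : realType} (p : R) (q r : \bar R) : Prop :=
  (p = 1 /\ q = 1%E /\ (1 <= r)%E) \/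
  (1 < p /\ (1 <= q)%E /\ (1 <= r)%E /\ (q <= r)%E).

(* Main.v *)
(* The hypotheses force p = p0 > 1, and one space depending only on p works for all
   q0 and r0: its maximal operator M is bounded on L^{p,1}, hence maps L^{p,1} to
   L^{p,r}, but it does not map L^{p,q} to L^{p,oo} for any q > 1.

   The space is a countable union of finite blocks with finite total mass. Block N is
   a tree with levels k = 0, ..., N; level k has n_k points of mass s_N w_k, where
   n_k w_k = w_k^p. A leaf is at distance 1 from its ancestors and all other distances
   are 2, so every ball is a point, a star or the whole space. On the leaves the
   averages over stars are comparable to A f(y) = sum_k (w_k / w_N) f(y_k), where y_k
   is the ancestor of y on level k, and A restricted to functions living on one level
   preserves all L^{p,q} quasinorms.

   Upper bound: as L^{p,1} is normable, the norm of A f is at most p times the sum of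
   the norms of the restrictions f_k of f to the levels. The w_k grow so fast that the
   sum over all levels of mu(f_k > t)^(1/p) is at most 4 mu(f > t)^(1/p).

   Lower bound: if f = 1 / w_k on the levels k < N of block N, then A f = N / w_N on
   the leaves, so the weak norm of M f is of order N s_N^(1/p), while the L^{p,q}
   quasinorm of f is of order N^(1/q) s_N^(1/p). *)

Require Import Defs.
From HB Require Import structures.
From mathcomp Require Import all_boot all_order all_algebra.
From mathcomp Require Import all_classical all_reals all_analysis.
From mathcomp Require Import measurable_realfun ring lra.
Set Implicit Arguments. Unset Strict Implicit. Unset Printing Implicit Defensive.
Import Order.TTheory GRing.Theory Num.Theory.
Local Open Scope classical_set_scope.
Local Open Scope ring_scope.

(** * Monotonicity of powers, and subadditivity for exponents at most 1 *)

Section Powers.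
Context {R : realType}.
Implicit Types (x y : \bar R) (a : R).

Lemma le_poweR2r a x y : 0 <= a -> (0 <= x)%E -> (x <= y)%E ->
  (poweR x a <= poweR y a)%E.
Proof.
move=> a0 x0 xy; apply: gt0_ler_poweR => //.
  by rewrite in_itv /= x0 leey.
by rewrite in_itv /= (le_trans x0 xy) leey.
Qed.

(** With s = x + y, the fractions x / s and y / s lie in [0, 1] and add up to 1, and each fraction u
    satisfies u <= u^a. *)
Lemma powRD_le a (x y : R) : 0 <= a <= 1 -> 0 <= x -> 0 <= y ->
  (x + y) `^ a <= x `^ a + y `^ a.
Proof.
move=> /andP[a0 a1] x0 y0.
have [->|x0'] := eqVneq x 0; first by rewrite add0r lerDr powR_ge0.
have xp : 0 < x by rewrite lt_neqAle eq_sym x0'.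
have sp : 0 < x + y by rewrite ltr_pwDl.
have frac z : 0 <= z -> z <= x + y -> z / (x + y) * (x + y) `^ a <= z `^ a.
  move=> z0 zs; have [->|zn0] := eqVneq z 0; first by rewrite !mul0r powR_ge0.
  rewrite [leRHS](_ : _ = (z / (x + y)) `^ a * (x + y) `^ a); last first.
    by rewrite -powRM ?divfK ?gt_eqF// ?divr_ge0// ltW.
  rewrite ler_wpM2r ?powR_ge0//.
  apply: ger1_powR => //; rewrite ler_pdivrMr// mul1r zs andbT.
  by rewrite divr_gt0// lt_neqAle eq_sym zn0.
have -> : (x + y) `^ a = x / (x + y) * (x + y) `^ a + y / (x + y) * (x + y) `^ a.
  by rewrite -mulrDl -mulrDl divff ?mul1r// gt_eqF.
by apply: lerD; apply: frac; rewrite // ?lerDl ?lerDr.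
Qed.

Lemma poweRD_le a x y : 0 < a <= 1 -> (0 <= x)%E -> (0 <= y)%E ->
  (poweR (x + y) a <= poweR x a + poweR y a)%E.
Proof.
move=> /andP[a0 a1]; case: x => [x||]//; case: y => [y||]// x0 y0.
- rewrite -EFinD !poweR_EFin -EFinD lee_fin; apply: powRD_le => //.
  by rewrite ltW.
- by rewrite addey// !poweRyr ?gt_eqF// addey.
- by rewrite addye// !poweRyr ?gt_eqF// addye.
- by rewrite !poweRyr ?gt_eqF.
Qed.

(** Finite subadditivity passes to the limit once the exponent is moved to the other side: every
    partial sum of u is at most S^(1/a), where S is the series on the right. *)
Lemma poweR_nneseries_le a (u : nat -> \bar R) : 0 < a <= 1 ->
  (forall n, 0 <= u n)%E ->
  (poweR (\sum_(0 <= n <oo) u n) a <= \sum_(0 <= n <oo) poweR (u n) a)%E.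
Proof.
move=> a01 u0; have /andP[a0 a1] := a01.
have fin k : (poweR (\sum_(0 <= n < k) u n) a <= \sum_(0 <= n < k) poweR (u n) a)%E.
  elim: k => [|k IH]; first by rewrite !big_nil poweR0r ?gt_eqF.
  rewrite !big_nat_recr//=; apply: le_trans (leeD2r _ IH).
  by apply: poweRD_le => //; exact: sume_ge0.
set S := (X in (_ <= X)%E).
have S0 : (0 <= S)%E by apply: nneseries_ge0 => n _ _; exact: poweR_ge0.
have US : (\sum_(0 <= n <oo) u n <= poweR S a^-1)%E.
  apply: lime_le; first exact: is_cvg_nneseries.
  apply: nearW => k /=.
  have uk0 : (0 <= \sum_(0 <= n < k) u n)%E by exact: sume_ge0.
  rewrite -[leLHS]poweRe1// -(divff (lt0r_neq0 a0)) poweRrM.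
  apply: le_poweR2r; [by rewrite invr_ge0 ltW|exact: poweR_ge0|].
  apply: (le_trans (fin k)); apply: nneseries_lim_ge => n _ _.
  exact: poweR_ge0.
rewrite -[leRHS]poweRe1// -(mulVf (lt0r_neq0 a0)) poweRrM.
by apply: le_poweR2r => //; [exact: ltW|exact: nneseries_ge0].
Qed.

Lemma powR_count_ni (I : finType) (u : I -> R) (a s t : R) : 0 <= a -> s <= t ->
  #|[pred i | t < u i]|%:R `^ a <= #|[pred i | s < u i]|%:R `^ a.
Proof.
move=> a0 st; apply: ge0_ler_powR; rewrite ?nnegrE ?ler0n// ler_nat.
apply: subset_leq_card; apply/fintype.subsetP => i.
by rewrite !inE; exact: le_lt_trans.
Qed.

End Powers.

(** * Comparison of integrals, and step functions on the positive half-line *)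

Section Integrals.
Context {R : realType}.

(* The nonnegative integral is a supremum over simple functions, hence monotone
   without measurability. *)
Lemma ge0_integral_mono d (T : measurableType d)
    (mu : {measure set T -> \bar R}) (D : set T) (f g : T -> \bar R) :
  (forall x, D x -> 0 <= f x)%E -> (forall x, D x -> f x <= g x)%E ->
  (\int[mu]_(x in D) f x <= \int[mu]_(x in D) g x)%E.
Proof.
move=> f0 fg; have g0 x : D x -> (0 <= g x)%E.
  by move=> Dx; rewrite (le_trans (f0 _ Dx))// fg.
rewrite !ge0_integralE//; apply: ge_ereal_sup => _ /= [h hf <-].
apply: ereal_sup_ubound; exists h => // x; apply: (le_trans (hf x)).
by rewrite /patch; case: ifPn => // /[!inE]; exact: fg.
Qed.

Lemma ge0_integral_subset d (T : measurableType d)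
    (mu : {measure set T -> \bar R}) (A B : set T) (f : T -> \bar R) :
  (forall x, B x -> 0 <= f x)%E -> A `<=` B ->
  (\int[mu]_(x in A) f x <= \int[mu]_(x in B) f x)%E.
Proof.
move=> f0 AB; rewrite integral_mkcond [leRHS]integral_mkcond.
apply: ge0_integral_mono => x _; rewrite /patch.
  by case: ifPn => // /[!inE] /AB; exact: f0.
case: ifPn => [/[!inE] /AB Bx|_]; first by rewrite mem_set.
by case: ifPn => // /[!inE]; exact: f0.
Qed.

(** Superlevel sets of a nonincreasing function are intervals. This supplies measurability in t for
    the distribution functions integrated below. *)
Lemma nonincreasing_emeasurable (D : set R) (f : R -> \bar R) : measurable D ->
  (forall s t, s <= t -> (f t <= f s)%E) -> measurable_fun D f.
Proof.
move=> mD fni; apply: (measurability _ (ErealGenOInfty.measurableE R)).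
move=> _ [_ [r ->] <-]; apply: measurableI => //.
apply: is_interval_measurable => s t /=.
rewrite !in_itv /= !andbT => fs ft u /andP[su ut].
by rewrite in_itv /= andbT (lt_le_trans ft)// fni.
Qed.

Local Notation pos := (`]0%R, +oo[%classic : set R).

Lemma integral_ltr_nat (c : R) : 0 <= c ->
  (\int[lebesgue_measure]_(t in pos) ((t < c)%R%:R)%:E = c%:E)%E.
Proof.
move=> c0.
transitivity (\int[lebesgue_measure]_(t in pos)
    (\1_(`]-oo, c[%classic : set R) t)%:E)%E.
  by apply: eq_integral => t _; rewrite indicE mem_setE /= in_itv.
  rewrite integral_indic// (_ : _ `&` _ = `]0, c[%classic).
    rewrite [LHS](lebesgue_measure_itv `]0, c[) /= lte_fin.
    by case: ltgtP c0 => // [_|<-] _; rewrite ?sube0.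
  by apply/seteqP; split => t /=; rewrite !in_itv /= ?andbT;
    [move=> [-> ->]|move=> /andP[-> ->]].
Qed.

(** Serves to write a sum of products as an integral over heights t, so that sums can be compared
    pointwise in t. *)
Lemma integral_step (I : Type) (s : seq I) (a c : I -> R) :
  (forall i, 0 <= a i) -> (forall i, 0 <= c i) ->
  (\int[lebesgue_measure]_(t in pos) (\sum_(i <- s) a i * (t < c i)%R%:R)%:E
   = (\sum_(i <- s) a i * c i)%:E)%E.
Proof.
move=> a0 c0.
have mlt i : measurable_fun pos (fun t : R => (t < c i)%R%:R : R).
  apply: nonincreasing_measurable => // u t ut; rewrite ler_nat.
  by case: (ltP t) => // tc; rewrite (le_lt_trans ut tc).
under eq_integral do rewrite -sumEFin.
rewrite ge0_integral_sum//; last 2 first.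
- move=> i; apply/measurable_EFinP; apply: measurable_funM; last exact: mlt.
  exact: measurable_cst.
- by move=> i t _; rewrite lee_fin mulr_ge0.
rewrite -sumEFin; apply: eq_bigr => i _.
under eq_integral do rewrite EFinM.
rewrite ge0_integralZl_EFin ?integral_ltr_nat//.
by apply/measurable_EFinP; exact: mlt.
Qed.

End Integrals.

(** * Minkowski's inequality in L^{p,1} over a finite set *)

Section Minkowski.
Context {R : realType} {I : finType} (p : R).
Hypothesis p1 : 1 < p.
Local Notation pos := (`]0%R, +oo[%classic : set R).

Let p0 : 0 < p. Proof. by rewrite (lt_trans _ p1). Qed.

(** Discrete form of the fact that p x^(1/p) has the decreasing derivative x^(1/p - 1). With m = n +
    1, it is Young's inequality for ((m - 1) / m)^(1/p) and 1, multiplied by p m^(1/p). *)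
Lemma powR_inv_step (n : nat) :
  p * n%:R `^ p^-1 + n.+1%:R `^ (p^-1 - 1) <= p * n.+1%:R `^ p^-1.
Proof.
set m : R := n.+1%:R; have m0 : 0 < m by rewrite ltr0n.
have mE : n%:R = m - 1 by rewrite /m -natr1 addrK.
pose q := p / (p - 1).
have pq : p^-1 + q^-1 = 1 by rewrite /q; field; rewrite subr_eq0 !gt_eqF.
have q0 : 0 < q by rewrite divr_gt0 ?subr_gt0.
have x0 : 0 <= (m - 1) / m by rewrite -mE divr_ge0 ?ler0n// ltW.
have := @conjugate_powR R (((m - 1) / m) `^ p^-1) 1 p q (powR_ge0 _ _) ler01 p0 q0 pq.
rewrite mulr1 -powRrM mulVf ?gt_eqF// powRr1// powR1 => le1.
have E : n%:R `^ p^-1 = ((m - 1) / m) `^ p^-1 * m `^ p^-1.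
  by rewrite -powRM ?divfK ?gt_eqF ?mE// ltW.
have E2 : m `^ (p^-1 - 1) = m `^ p^-1 / m.
  by rewrite powRB ?powRr1// ?ltW//; apply/implyP => _; rewrite gt_eqF.
rewrite E E2.
set u := (_ `^ _) in le1 *; set v := m `^ p^-1.
have v0 : 0 <= v by exact: powR_ge0.
have le2 : p * u + m^-1 <= p.
  have : p * u <= p * (((m - 1) / m / p) + 1 / q) by rewrite ler_pM2l.
  have -> : 1 / q = 1 - p^-1 by rewrite div1r -pq addrC addKr.
  have -> : p * ((m - 1) / m / p + (1 - p^-1)) = p - m^-1.
    by field; rewrite !gt_eqF.
  by rewrite lerBrDr.
have : (p * u + m^-1) * v <= p * v by rewrite ler_wpM2r.
by rewrite mulrDl [m^-1 * v]mulrC mulrA.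
Qed.

(* The weight dual to [g] in the [p]-th root norm; pairing with it linearizes the
   norm of [g] up to a factor [p]. *)
Let weight (g : I -> R) (i : I) : R :=
  #|[pred j | g i <= g j]|%:R `^ (p^-1 - 1).

(** For i in A = {g > t}, the set counted by [weight g i] lies in A. As the exponent is negative,
    each of the #|A| weights is at least #|A|^(1/p - 1). *)
Lemma weight_superlevel (g : I -> R) (t : R) :
  #|[pred i | t < g i]|%:R `^ p^-1 <= \sum_i weight g i * (t < g i)%R%:R.
Proof.
set A := [pred i | t < g i].
have [A0|A0] := posnP #|A|.
  by rewrite A0 powR0 ?invr_neq0 ?gt_eqF// sumr_ge0// => i _; rewrite mulr_ge0// powR_ge0.
have c0 : (0 : R) < #|A|%:R by rewrite ltr0n.
have -> : #|A|%:R `^ p^-1 = \sum_(i in A) #|A|%:R `^ (p^-1 - 1).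
  rewrite sumr_const -[RHS]mulr_natl powRB ?powRr1 ?ler0n//; last first.
    by apply/implyP => _; rewrite gt_eqF.
  by rewrite mulrC divfK ?gt_eqF.
rewrite [leRHS](bigID (mem A)) /=.
rewrite [X in _ <= _ + X]big1 ?addr0; last first.
  by move=> i /negbTE; rewrite inE => ->; rewrite mulr0.
apply: ler_sum => i; rewrite inE => ti; rewrite ti mulr1 /weight.
set B := [pred j | _].
have BA : (#|B| <= #|A|)%N.
  by apply: subset_leq_card; apply/fintype.subsetP => j; rewrite !inE; exact: lt_le_trans.
have B0 : (0 < #|B|)%N by apply/card_gt0P; exists i; rewrite inE lexx.
rewrite -(opprB 1) !powRN.
have e0 : 0 <= 1 - p^-1 by rewrite subr_ge0 invf_le1// ltW.
rewrite lef_pV2 ?posrE ?powR_gt0 ?ltr0n//.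
by apply: ge0_ler_powR; rewrite ?nnegrE ?ler0n// ler_nat.
Qed.

(** Induction that removes a minimizer i of g on A: the weight of i counts all of A, hence is at
    most #|A|^(1/p - 1), the increment allowed by [powR_inv_step]. *)
Lemma sum_weight_le (g : I -> R) (A : {set I}) :
  \sum_(i in A) weight g i <= p * #|A|%:R `^ p^-1.
Proof.
move: {2}#|A| (leqnn #|A|) => n; elim: n A => [|n IH] A.
  rewrite leqn0 cards_eq0 => /eqP ->; rewrite big_set0.
  by rewrite mulr_ge0 ?powR_ge0 ?ltW.
move=> An; have [->|[i0 i0A]] := set_0Vmem A.
  by rewrite big_set0 mulr_ge0 ?powR_ge0 ?ltW.
case: (arg_minP g i0A) => i iA' imin; have iA : i \in A by exact: iA'.
have cA : #|A| = #|(A :\ i)%SET|.+1 by rewrite (cardsD1 i) iA.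
rewrite (big_setD1 i)//= addrC cA.
apply: le_trans (powR_inv_step _); apply: lerD.
  by apply: IH; rewrite -ltnS -cA.
rewrite -cA /weight; set B := [pred j | _].
have AB : (#|A| <= #|B|)%N.
  by apply: subset_leq_card; apply/fintype.subsetP => j jA; rewrite inE imin.
have A0 : (0 < #|A|)%N by rewrite cA.
rewrite -(opprB 1) !powRN.
have e0 : 0 <= 1 - p^-1 by rewrite subr_ge0 invf_le1// ltW.
rewrite lef_pV2 ?posrE ?powR_gt0 ?ltr0n// ?(leq_trans A0)//.
by apply: ge0_ler_powR; rewrite ?nnegrE ?ler0n// ler_nat.
Qed.

(** Let G be the whole sum and h its weight. The left side is at most the pairing of h with G, which
    is linear in G and so splits over k. By [sum_weight_le], the same h paired with a single g k
    costs only the factor p. *)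
Lemma count_minkowski (K : Type) (s : seq K) (c : K -> R) (g : K -> I -> R) :
  (forall k, 0 <= c k) -> (forall k i, 0 <= g k i) ->
  (\int[lebesgue_measure]_(t in pos)
     (#|[pred i | (t < \sum_(k <- s) c k * g k i)%R]|%:R `^ p^-1)%:E <=
   \sum_(k <- s) (p * c k)%:E *
     \int[lebesgue_measure]_(t in pos) (#|[pred i | (t < g k i)%R]|%:R `^ p^-1)%:E)%E.
Proof.
move=> c0 g0; pose G i := \sum_(k <- s) c k * g k i; pose h := weight G.
have h0 i : 0 <= h i by exact: powR_ge0.
have G0 i : 0 <= G i by apply: sumr_ge0 => k _; rewrite mulr_ge0.
apply: (@le_trans _ _ (\sum_i h i * G i)%:E).
  rewrite -(integral_step (index_enum I))//; apply: ge0_integral_mono => t _.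
    by rewrite lee_fin powR_ge0.
  by rewrite lee_fin weight_superlevel.
have -> : \sum_i h i * G i = \sum_(k <- s) c k * \sum_i h i * g k i.
  under eq_bigr do rewrite mulr_sumr.
  rewrite exchange_big /=; apply: eq_bigr => k _.
  by rewrite mulr_sumr; apply: eq_bigr => i _; rewrite mulrCA.
rewrite -sumEFin; apply: lee_sum => k _; rewrite EFinM [(p * c k)%:E]EFinM.
rewrite (muleC p%:E) -muleA; apply: lee_wpmul2l; first by rewrite lee_fin.
rewrite -(integral_step (index_enum I))//.
rewrite -ge0_integralZl_EFin//; last 2 first.
- apply: nonincreasing_emeasurable => // u t ut; rewrite lee_fin.
  by apply: powR_count_ni; rewrite // invr_ge0 ltW.
- exact: ltW.
apply: ge0_integral_mono => t _.
  by rewrite lee_fin sumr_ge0// => i _; rewrite mulr_ge0.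
rewrite -EFinM lee_fin.
have -> : #|[pred i | t < g k i]| = #|finset (fun i => t < g k i)|.
  by apply: eq_card => i; rewrite !inE.
apply: le_trans (sum_weight_le G _).
rewrite [leRHS]big_mkcond /=; apply: ler_sum => i _; rewrite inE.
by case: (t < _); rewrite ?mulr1 ?mulr0.
Qed.

End Minkowski.

(** * Lorentz quasinorms *)

Section Lorentz.
Context {R : realType} {d : measure_display} {T : measurableType d}.
Variables (mu : {measure set T -> \bar R}) (p : R).
Hypothesis p1 : 1 <= p.
Implicit Types (f g : T -> \bar R).
Local Notation pos := (`]0%R, +oo[%classic : set R).
Local Open Scope ereal_scope.

Let p0 : (0 < p)%R. Proof. by rewrite (lt_le_trans _ p1). Qed.
Let ip0 : (0 <= p^-1)%R. Proof. by rewrite invr_ge0 ltW. Qed.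

Lemma outer_mu_ge0 A : 0 <= outer_mu mu A.
Proof. by apply: le_ereal_inf_tmp => _ [B _ <-]. Qed.

Lemma le_outer_mu A B : A `<=` B -> outer_mu mu A <= outer_mu mu B.
Proof.
move=> AB; apply: le_ereal_inf_tmp => _ [C [mC BC] <-].
by apply: ereal_inf_lbound; exists C => //; split => //; apply: subset_trans BC.
Qed.

Lemma outer_muE A : measurable A -> outer_mu mu A = mu A.
Proof.
move=> mA; apply/eqP; rewrite eq_le; apply/andP; split.
  apply: ereal_inf_lbound => /=; exists A => //; by split.
by apply: le_ereal_inf_tmp => _ [B [mB AB] <-]; apply: le_measure; rewrite ?inE.
Qed.

Lemma distrib_ni f s t : (s <= t)%R -> distrib mu f t <= distrib mu f s.
Proof.
by move=> st; apply: le_outer_mu => x /=; apply: le_lt_trans; rewrite lee_fin.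
Qed.

Lemma distrib_ge0 f t : 0 <= distrib mu f t.
Proof. exact: outer_mu_ge0. Qed.

Definition distrib_root f (t : R) : \bar R := poweR (distrib mu f t) p^-1.

Lemma distrib_root_ge0 f t : 0 <= distrib_root f t.
Proof. exact: poweR_ge0. Qed.

Lemma distrib_root_ni f s t : (s <= t)%R -> distrib_root f t <= distrib_root f s.
Proof. by move=> st; exact: le_poweR2r ip0 (distrib_ge0 _ _) (distrib_ni _ st). Qed.

Lemma measurable_distrib_root f D : measurable D ->
  measurable_fun D (distrib_root f).
Proof. by move=> mD; apply: nonincreasing_emeasurable => // s t; exact: distrib_root_ni. Qed.

Definition root_integral f := \int[lebesgue_measure]_(t in pos) distrib_root f t.

Lemma root_integral_ge0 f : 0 <= root_integral f.
Proof. by apply: integral_ge0 => t _; exact: distrib_root_ge0. Qed.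

Lemma lorentz1E f : lorentz mu p 1 f = p%:E * root_integral f.
Proof.
rewrite /lorentz /= invr1 powRr1 ?ltW// poweRe1; last first.
  apply: integral_ge0 => t; rewrite /= in_itv /= andbT => t0.
  by rewrite mule_ge0 ?poweR_ge0// lee_fin invr_ge0 ltW.
congr (_ * _); apply: eq_integral => t; rewrite inE /= in_itv /= andbT => t0.
rewrite poweRe1; last by rewrite mule_ge0 ?poweR_ge0// lee_fin ltW.
by rewrite muleAC -EFinM divff ?gt_eqF// mul1e.
Qed.

(** Chebyshev's inequality: on ]0, t] the integrand is at least its value at t. *)
Lemma tdistrib_root_le f (t : R) : (0 < t)%R ->
  t%:E * distrib_root f t <= root_integral f.
Proof.
move=> t0.
have -> : t%:E * distrib_root f t =
    \int[lebesgue_measure]_(s in (`]0%R, t]%classic : set R)) cst (distrib_root f t) s.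
  rewrite integral_cst// [X in _ = _ * X](lebesgue_measure_itv `]0%R, t]) /=.
  by rewrite lte_fin t0 sube0 muleC.
apply: (@le_trans _ _ (\int[lebesgue_measure]_(s in (`]0%R, t]%classic : set R)) distrib_root f s)).
  apply: ge0_integral_mono => s; rewrite /= in_itv /= => /andP[_ st].
    exact: distrib_root_ge0.
  exact: distrib_root_ni.
apply: ge0_integral_subset => //.
- by move=> *; exact: distrib_root_ge0.
- by move=> s; rewrite /= !in_itv /= andbT => /andP[].
Qed.

(** Let D be the root of the distribution function and K its integral. Then (t D)^r / t = (t
    D)^(r-1) D <= K^(r-1) D by Chebyshev, which integrates to K^r; moreover p^(1/r) <= p. *)
Lemma lorentz_le_lorentz1 r f : 1 <= r -> lorentz mu p r f <= lorentz mu p 1 f.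
Proof.
move=> r1; rewrite lorentz1E.
have K0 := root_integral_ge0 f.
have Kp : root_integral f <= p%:E * root_integral f.
  by rewrite -[leLHS]mul1e lee_wpmul2r// lee_fin.
case: r r1 => [r||]// r1; last first.
  apply: le_trans Kp; apply: ge_ereal_sup => _ [t t0 <-].
  exact: tdistrib_root_le.
rewrite lee_fin in r1; have r0 : (0 < r)%R by rewrite (lt_le_trans _ r1).
have [Koo|Kfin] := eqVneq (root_integral f) +oo.
  by rewrite Koo gt0_muley ?lte_fin// leey.
have {}Kfin : root_integral f \is a fin_num by rewrite ge0_fin_numE// ltey.
set k := fine (root_integral f); have kE : k%:E = root_integral f by rewrite fineK.
have k0 : (0 <= k)%R by rewrite fine_ge0.
have pr : (p `^ r^-1 <= p)%R by rewrite ler1_powR// invf_le1.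
rewrite /lorentz; apply: lee_pmul; rewrite ?lee_fin ?powR_ge0 ?poweR_ge0//.
have E : root_integral f = poweR (poweR (root_integral f) r) r^-1.
  by rewrite -poweRrM divff ?gt_eqF// poweRe1.
rewrite [leRHS]E; apply: le_poweR2r; first by rewrite invr_ge0 ltW.
  apply: integral_ge0 => t; rewrite /= in_itv /= andbT => t0.
  by rewrite mule_ge0 ?poweR_ge0// lee_fin invr_ge0 ltW.
have -> : poweR (root_integral f) r = (k `^ (r - 1))%:E * root_integral f.
  by rewrite -kE poweR_EFin -EFinM mulrC mulr_powRB1.
rewrite -ge0_integralZl_EFin ?powR_ge0//; last 2 first.
- by move=> *; exact: distrib_root_ge0.
- exact: measurable_distrib_root.
apply: ge0_integral_mono => t; rewrite /= in_itv /= andbT => t0.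
  by rewrite mule_ge0 ?poweR_ge0// lee_fin invr_ge0 ltW.
have := tdistrib_root_le f t0; rewrite -kE -/(distrib_root f t).
have := distrib_root_ge0 f t.
case: (distrib_root f t) => [x||]//; last first.
  by move=> _; rewrite gt0_muley ?lte_fin.
rewrite lee_fin => x0; rewrite -!EFinM !lee_fin => tx.
have tx0 : (0 <= t * x)%R by rewrite mulr_ge0// ltW.
rewrite -mulr_powRB1// [leLHS](_ : _ = ((t * x) `^ (r - 1) * x)%R); last first.
  by field; rewrite gt_eqF.
rewrite ler_wpM2r// ge0_ler_powR ?nnegrE// ?subr_ge0//.
Qed.

(** For finite r, only ]t/2, t] is kept in the integral. There D(s) >= D(t), s > t/2 and 1/s >= 1/t,
    so the integral is at least (t D(t) / 2)^r / 2. The r-th root loses at most another factor 2,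
    whence 4. *)
Lemma weak_le_lorentz r f (t : R) : (0 < t)%R -> 1 <= r ->
  t%:E * distrib_root f t <= 4%:E * lorentz mu p r f.
Proof.
move=> t0; case: r => [r||]// r1; last first.
  apply: (@le_trans _ _ (1 * lorentz mu p +oo f)).
    by rewrite mul1e; apply: ereal_sup_ubound; exists t.
  rewrite lee_wpmul2r ?lee_fin ?ler1n//.
  apply: (@le_trans _ _ (t%:E * distrib_root f t)).
    by rewrite mule_ge0 ?poweR_ge0// lee_fin ltW.
  by apply: ereal_sup_ubound; exists t.
rewrite lee_fin in r1; have r0 : (0 < r)%R by rewrite (lt_le_trans _ r1).
set D := distrib_root f t; have D0 : 0 <= D by exact: distrib_root_ge0.
have h0 : (0 < t / 2)%R by rewrite divr_gt0.
have I_ge : poweR ((t / 2)%:E * D) r * (2^-1)%:E <=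
    \int[lebesgue_measure]_(s in pos)
      (poweR (s%:E * distrib_root f s) r * (s^-1)%:E).
  have -> : poweR ((t / 2)%:E * D) r * (2^-1)%:E =
      \int[lebesgue_measure]_(s in (`](t / 2)%R, t]%classic : set R))
        cst (poweR ((t / 2)%:E * D) r * (t^-1)%:E) s.
    rewrite integral_cst// [X in _ = _ * X](lebesgue_measure_itv `](t / 2)%R, t]) /=.
    rewrite lte_fin ltr_pdivrMr// ltr_pMr// ltr1n -EFinB -muleA -EFinM.
    by congr (_ * _%:E); field; rewrite gt_eqF.
  apply: (@le_trans _ _ (\int[lebesgue_measure]_(s in (`](t / 2)%R, t]%classic : set R))
      (poweR (s%:E * distrib_root f s) r * (s^-1)%:E))).
    apply: ge0_integral_mono => s; rewrite /= in_itv /= => /andP[ts st].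
      by rewrite mule_ge0 ?poweR_ge0// lee_fin invr_ge0 ltW.
    have s0 : (0 < s)%R by exact: lt_trans ts.
    apply: lee_pmul; rewrite ?poweR_ge0 ?lee_fin ?invr_ge0 ?(ltW t0)//.
      apply: le_poweR2r; [exact: ltW|by rewrite mule_ge0// lee_fin ltW|].
      apply: lee_pmul => //; rewrite ?lee_fin; [exact: ltW|exact: ltW|].
      exact: distrib_root_ni.
    by rewrite lef_pV2.
  apply: ge0_integral_subset => //.
  - move=> s; rewrite /= in_itv /= andbT => s0.
    by rewrite mule_ge0 ?poweR_ge0// lee_fin invr_ge0 ltW.
  - move=> s; rewrite /= !in_itv /= andbT => /andP[ts _]; exact: lt_trans ts.
have Jle : (t / 2)%:E * D * (2^-1)%:E <= lorentz mu p (r%:E) f.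
  rewrite /lorentz.
  set J := integral _ _ _ in I_ge *.
  apply: (@le_trans _ _ (poweR J r^-1)); last first.
    rewrite -[leLHS]mul1e lee_wpmul2r ?poweR_ge0// lee_fin.
    by rewrite -[leLHS](powRr0 p) ler_powR// invr_ge0 ltW.
  have tD0 : 0 <= (t / 2)%:E * D by rewrite mule_ge0// lee_fin ltW.
  apply: (@le_trans _ _ (poweR (poweR ((t / 2)%:E * D) r * (2^-1)%:E) r^-1)).
    rewrite poweRM ?poweR_ge0// -poweRrM divff ?gt_eqF// poweRe1//.
    apply: lee_wpmul2l => //; rewrite poweR_EFin lee_fin.
    by rewrite ger1_powR// ?invf_le1 ?invr_gt0 ?ltr0n ?ler1n.
  apply: le_poweR2r => //; first by rewrite invr_ge0 ltW.
  by rewrite mule_ge0 ?poweR_ge0.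
have : 4%:E * ((t / 2)%:E * D * (2^-1)%:E) <= 4%:E * lorentz mu p (r%:E) f.
  by rewrite lee_wpmul2l.
apply: le_trans; rewrite muleAC -EFinM muleA -EFinM.
by rewrite (_ : (4 * (t / 2 / 2) = t)%R)//; field.
Qed.

End Lorentz.

(** * The layer cake formula for weighted sums of Dirac masses *)

Section LayerCake.
Context {R : realType} {d : measure_display} {T : measurableType d}.
Variables (w : nat -> {nonneg R}) (x : nat -> T).
Local Notation pos := (`]0%R, +oo[%classic : set R).
Local Open Scope ereal_scope.

Let mu := mseries (fun n => mscale (w n) (dirac (x n))) 0.

(** Both sides are series over the atoms, and for a single atom the identity is [integral_step] with
    one term. *)
Lemma layer_cake (f : T -> R) : (forall A : set T, measurable A) ->
  (forall y, 0 <= f y)%R ->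
  \int[mu]_y (f y)%:E =
  \int[lebesgue_measure]_(t in pos) mu [set y | (t < f y)%R].
Proof.
move=> mT f0.
have mf : measurable_fun setT (EFin \o f) by move=> _ Y _; exact: mT.
rewrite ge0_integral_measure_series//; last by move=> t _; rewrite lee_fin.
transitivity (\sum_(0 <= n <oo)
   \int[lebesgue_measure]_(t in pos) ((w n)%:num * (t < f (x n))%R%:R)%:E).
  apply: eq_eseriesr => n _.
  rewrite ge0_integral_mscale//; last by move=> *; rewrite lee_fin.
  rewrite integral_dirac// diracT mul1e.
  have := @integral_step R nat [:: n] (fun n => (w n)%:num) (fun n => f (x n)).
  rewrite big_seq1 -EFinM => <-//.
  by apply: eq_integral => t _; rewrite big_seq1.
rewrite -integral_nneseries//; last first.
  move=> n; apply: nonincreasing_emeasurable => // s t st.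
  rewrite lee_fin ler_wpM2l// ler_nat.
  by case: (ltP t) => // tc; rewrite (le_lt_trans st tc).
apply: eq_integral => t _; apply: eq_eseriesr => n _.
transitivity ((w n)%:num%:E * \d_(x n) [set y | (t < f y)%R]); last by [].
rewrite diracE EFinM; suff -> : (x n \in [set y | (t < f y)%R]) = (t < f (x n))%R by [].
by apply/idP/idP; rewrite inE.
Qed.

End LayerCake.

(** * Sparse levels *)

Section Levels.
Context {R : realType} (p : R).
Hypothesis p1 : 1 < p.

Let p0 : 0 < p. Proof. exact: lt_trans p1. Qed.

(** Level sizes are powers of 2 with nondecreasing exponents, so each divides the later ones and all
    nodes of a level have equally many leaves below. Up to the scale of the block, the p-th root of
    the mass is w_k for a whole level and w_k^(1/p) for one of its points. So [level_sparse] makes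
    the levels below j, taken together, at most half of one point on level j. *)
Record levels (e : nat -> nat) (w : nat -> R) : Prop := Levels {
  level_homo : {homo e : i j / (i <= j)%N};
  level_ge1 : forall k, 1 <= w k;
  level_total : forall k, (2 ^ e k)%:R * w k = w k `^ p;
  level_sparse : forall j, \sum_(k < j) w k <= w j `^ p^-1 / 2 }.

Lemma levels_exist : exists e w, levels e w.
Proof.
(* In exponents of 2, the growth 4 w_k <= w_(k+1)^(1/p) reads p (2 (p - 1) + E) <= a E with E = a^k
   >= 1; this holds as soon as a >= p + 2 p (p - 1). *)
pose a := (Num.trunc (p + 2 * p * (p - 1))).+1.
have ha : p + 2 * p * (p - 1) < a%:R by exact: truncnS_gt.
have pm : 0 < p - 1 by rewrite subr_gt0.
(* This [w k] is the solution of n w = w^p for n = 2^(e k). *)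
pose e k := (a ^ k)%N; pose w k : R := 2 `^ ((e k)%:R / (p - 1)).
have e0 k : 0 <= (e k)%:R / (p - 1) by rewrite divr_ge0 ?ler0n// ltW.
have w1 k : 1 <= w k by rewrite -[leLHS](powRr0 2) ler_powR// ler1n.
have w_root k : w k `^ p^-1 <= w k.
  by rewrite ler1_powR// invf_le1// ltW.
have grow k : 4 * w k <= w k.+1 `^ p^-1.
  have -> : 4 = 2 `^ 2%:R :> R by rewrite powR_mulrn// -natrX.
  rewrite -powRD ?pnatr_eq0 ?implybT// /w -powRrM ler_powR ?ler1n//.
  rewrite /e expnS natrM; set E := (a ^ k)%:R.
  have E1 : 1 <= E :> R by rewrite ler1n expn_gt0.
  rewrite -mulrA ler_pdivlMr// -[leRHS]mulrC mulrC.
  rewrite -(ler_pM2r pm) mulrDl.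
  have -> : a%:R * (E / (p - 1)) * (p - 1) = a%:R * E.
    by field; rewrite gt_eqF.
  rewrite [X in X <= _](_ : _ = p * (2 * (p - 1) + E)); last first.
    by field; rewrite gt_eqF.
  have : (p + 2 * p * (p - 1)) * E <= a%:R * E.
    by rewrite ler_wpM2r ?(ltW ha)// (le_trans ler01).
  have : 2 * p * (p - 1) <= 2 * p * (p - 1) * E.
    by rewrite ler_peMr// !mulr_ge0 ?ler0n// ltW.
  lra.
exists e, w; split => //.
- by move=> i j ij; rewrite /e leq_pexp2l.
- move=> k; rewrite natrX -powR_mulrn// -powRD ?pnatr_eq0 ?implybT//.
  by rewrite -powRrM; congr (_ `^ _); field; rewrite gt_eqF.
elim=> [|j IH]; first by rewrite big_ord0 divr_ge0 ?powR_ge0.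
rewrite big_ord_recr /=; have := grow j; have := w_root j; have := w1 j; lra.
Qed.

Section Fixed.
Variables (e : nat -> nat) (w : nat -> R).
Hypothesis ew : levels e w.

Let w1 k : 1 <= w k. Proof. exact: level_ge1 ew k. Qed.

Lemma level_gt0 k : 0 < w k. Proof. by rewrite (lt_le_trans ltr01). Qed.

Lemma level_root_ge1 k : 1 <= w k `^ p^-1.
Proof. by rewrite -[leLHS](powRr0 (w k)) ler_powR// invr_ge0 ltW. Qed.

Lemma level_root_le k : w k `^ p^-1 <= w k.
Proof. by rewrite ler1_powR// invf_le1// ltW. Qed.

Lemma sum_level_le N : \sum_(k < N.+1) w k <= 2 * w N.
Proof.
rewrite big_ord_recr /=; have := level_sparse ew N.
by have := level_root_le N; have := w1 N; lra.
Qed.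

(** The p-th root of the mass factor s_N. By [scaleS], the leaf level of block N + 1 has root mass
    [scale N / 4], whereas every single point of block N has root mass at least [scale N]. *)
Definition scale (N : nat) : R := \prod_(j < N.+1) (4 * w j)^-1.

Lemma scale_gt0 N : 0 < scale N.
Proof. by apply: prodr_gt0 => j _; rewrite invr_gt0 mulr_gt0// level_gt0. Qed.

Lemma scaleS N : scale N.+1 * w N.+1 = scale N / 4.
Proof.
rewrite /scale big_ord_recr /= -/(scale N); have := level_gt0 N.+1 => ?.
by field; rewrite gt_eqF.
Qed.

Lemma scaleS_le N : scale N.+1 <= scale N / 4.
Proof. by rewrite -scaleS ler_peMr// ltW// scale_gt0. Qed.

Lemma scale_tail m M :
  \sum_(m.+1 <= N < m.+1 + M) scale N * w N <= scale m / 2.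
Proof.
elim: M m => [|M IH] m.
  by rewrite addn0 big_geq// divr_ge0// ltW// scale_gt0.
rewrite big_ltn ?addnS ?ltnS ?leq_addr// scaleS.
have := IH m.+1; rewrite !addSn; have := scaleS_le m; have := scale_gt0 m; lra.
Qed.

Lemma scale_le N : scale N * w N <= 4^-1 ^+ N.+1.
Proof.
case: N => [|N].
  rewrite /scale big_ord1 expr1; have := level_gt0 0 => ?.
  by rewrite invfM mulfVK// gt_eqF.
rewrite scaleS exprSr ler_pM2r ?invr_gt0//.
elim: N => [|N IH].
  rewrite /scale big_ord1 expr1 lef_pV2 ?posrE ?mulr_gt0 ?level_gt0//.
  by rewrite ler_peMr.
by rewrite exprSr (le_trans (scaleS_le N))// ler_pM2r ?invr_gt0.
Qed.

(* A nonempty set at one level outweighs everything below it: levels are ordered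
   by increasing [N], then by decreasing [k]. *)
Lemma sum_levels_le (b : nat -> nat -> R) (B : R) :
  0 <= B ->
  (forall N k, (k <= N)%N -> 0 <= b N k <= scale N * w k) ->
  (forall N k, (k <= N)%N -> b N k <= B) ->
  (forall N k, (k <= N)%N -> b N k = 0 \/ scale N * w k `^ p^-1 <= b N k) ->
  forall M, \sum_(0 <= N < M) \sum_(k < N.+1) b N k <= 4 * B.
Proof.
move=> B0 bw bB bpos.
(* The last nonempty level contributes at most B, and by sparsity the levels below it at most B /
   2. *)
have inner N j : (j <= N.+1)%N -> \sum_(k < j) b N k <= 2 * B.
  elim: j => [|j IH] jN; first by rewrite big_ord0 mulr_ge0.
  rewrite big_ord_recr /=; have [->|bj] := bpos N j jN.
    by rewrite addr0 IH// ltnW.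
  have : \sum_(k < j) b N k <= scale N * \sum_(k < j) w k.
    rewrite mulr_sumr; apply: ler_sum => k _.
    by have /andP[] := bw N k (leq_trans (ltnW (ltn_ord k)) jN).
  have : scale N * \sum_(k < j) w k <= scale N * (w j `^ p^-1 / 2).
    by rewrite ler_pM2l ?scale_gt0//; exact: level_sparse ew j.
  have := bB N j jN; lra.
have small N : \sum_(k < N.+1) b N k = 0 \/ scale N <= B.
  have [/existsP[k bk]|] := boolP [exists k : 'I_N.+1, b N k != 0].
    right; have kN : (k <= N)%N by exact: ltn_ord k.
    have [b0|bge] := bpos N k kN; first by rewrite b0 eqxx in bk.
    apply: le_trans (bB N k kN); apply: le_trans bge.
    by rewrite ler_peMr ?level_root_ge1// ltW// scale_gt0.
  rewrite negb_exists => /forallP b0; left; apply: big1 => k _.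
  by apply/eqP; rewrite -[_ == _]negbK.
(* The first nonempty block m contributes at most 2 B and satisfies [scale m <= B]; all later blocks
   together contribute at most [scale m]. *)
have outer M m : \sum_(m <= N < m + M) \sum_(k < N.+1) b N k <= 4 * B.
  elim: M m => [|M IH] m; first by rewrite addn0 big_geq// mulr_ge0.
  rewrite big_ltn ?addnS ?ltnS ?leq_addr// -addSn.
  have [->|sB] := small m; first by rewrite add0r.
  have : \sum_(m.+1 <= N < m.+1 + M) \sum_(k < N.+1) b N k <=
      \sum_(m.+1 <= N < m.+1 + M) 2 * (scale N * w N).
    apply: ler_sum => N _; rewrite mulrCA.
    apply: le_trans (_ : scale N * \sum_(k < N.+1) w k <= _); last first.
      by rewrite ler_pM2l ?scale_gt0// sum_level_le.
    rewrite mulr_sumr; apply: ler_sum => k _.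
    by have /andP[] := bw N k (ltn_ord k).
  rewrite -mulr_sumr; have := scale_tail m M; have := inner m m.+1 (leqnn _).
  have := scale_gt0 m; lra.
by move=> M; rewrite -[M]add0n outer.
Qed.

End Fixed.
End Levels.

(** * The metric space *)

(* [(N, k, i)] is the [i]-th of the [2 ^ e k] points on level [k <= N] of block [N];
   the points on level [N] are the leaves of the block, and the ancestor of the
   [i]-th leaf on level [k] has index [i %% 2 ^ e k]. *)
Definition node (e : nat -> nat) :=
  {x : nat * nat * nat | (x.1.2 <= x.1.1)%N && (x.2 < 2 ^ e x.1.2)%N}.

Section Points.
Variable e : nat -> nat.

HB.instance Definition _ := Countable.on (node e).

Definition root_node : node e :=
  exist (fun x : nat * nat * nat => (x.1.2 <= x.1.1)%N && (x.2 < 2 ^ e x.1.2)%N)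
    (0, 0, 0)%N (expn_gt0 2 (e 0)).

HB.instance Definition _ := isPointed.Build (node e) root_node.

HB.instance Definition _ := @isMeasurable.Build default_measure_display
  (node e) (@discrete_measurable (node e)) (@discrete_measurable0 (node e))
  (@discrete_measurableC (node e)) (@discrete_measurableU (node e)).

Lemma measurable_node (A : set (node e)) : measurable A.
Proof. by []. Qed.

Definition block (x : node e) : nat := (val x).1.1.
Definition lev (x : node e) : nat := (val x).1.2.
Definition idx (x : node e) : nat := (val x).2.
(** Invalid coordinates are sent to [root_node], hence the bounds on k and i in the facts about
    [pt]. *)
Definition pt (N k i : nat) : node e := insubd root_node (N, k, i).

Lemma lev_le x : (lev x <= block x)%N.
Proof. by rewrite /lev /block; case/andP: (valP x). Qed.

Lemma idx_lt x : (idx x < 2 ^ e (lev x))%N.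
Proof. by rewrite /idx /lev; case/andP: (valP x). Qed.

Lemma val_pt N k i : (k <= N)%N -> (i < 2 ^ e k)%N -> val (pt N k i) = (N, k, i).
Proof. by move=> kN ik; rewrite val_insubd /= kN ik. Qed.

Lemma ptK x : pt (block x) (lev x) (idx x) = x.
Proof.
by apply: val_inj; rewrite val_pt ?lev_le ?idx_lt// /block /lev /idx; case: (val x) => [[]].
Qed.

Lemma block_pt N k i : (k <= N)%N -> (i < 2 ^ e k)%N -> block (pt N k i) = N.
Proof. by move=> kN ik; rewrite /block val_pt. Qed.

Lemma lev_pt N k i : (k <= N)%N -> (i < 2 ^ e k)%N -> lev (pt N k i) = k.
Proof. by move=> kN ik; rewrite /lev val_pt. Qed.

Lemma idx_pt N k i : (k <= N)%N -> (i < 2 ^ e k)%N -> idx (pt N k i) = i.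
Proof. by move=> kN ik; rewrite /idx val_pt. Qed.

(** The second argument has to be a leaf: internal nodes of the same block are not related to one
    another. A leaf counts as its own ancestor. *)
Definition anc (x y : node e) : bool :=
  [&& block x == block y, lev y == block y & idx x == idx y %% 2 ^ e (lev x)]%N.

Definition star (x : node e) : set (node e) :=
  [set y | [|| x == y, anc x y | anc y x]].

Definition leaf (x : node e) : bool := lev x == block x.

Lemma anc_leaf x : leaf x -> anc x x.
Proof. by move=> lx; rewrite /anc eqxx -/(leaf x) lx modn_small ?eqxx// idx_lt. Qed.

(** A leaf is an ancestor of no other leaf, since on the leaf level the index is already reduced. *)
Lemma star_leaf x : leaf x -> star x = [set y | anc y x].
Proof.
move=> lx; rewrite /star; apply/seteqP; split => y /=; last by move=> ->; rewrite !orbT.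
case/or3P => [/eqP<-|/and3P[/eqP cxy ly /eqP ixy]|//]; first exact: anc_leaf.
suff -> : y = x by exact: anc_leaf.
have lyx : lev y = lev x by rewrite (eqP ly) -cxy; move/eqP: lx.
by rewrite -(ptK x) -(ptK y) ixy -lyx cxy modn_small ?idx_lt.
Qed.

Section Metric.
Context {R : realType}.

Definition rho (x y : node e) : R :=
  if x == y then 0 else if anc x y || anc y x then 1 else 2.

Lemma rhoxx x : rho x x = 0.
Proof. by rewrite /rho eqxx. Qed.

Lemma rho_ge0 x y : 0 <= rho x y.
Proof. by rewrite /rho; case: ifP => // _; case: ifP. Qed.

Lemma rho_le2 x y : rho x y <= 2.
Proof. by rewrite /rho; case: ifP => // _; case: ifP => // _; rewrite ler1n. Qed.

Lemma rho_ge1 x y : x != y -> 1 <= rho x y.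
Proof. by rewrite /rho => /negbTE ->; case: ifP => // _; rewrite ler1n. Qed.

(** The triangle inequality holds because nonzero distances lie between 1 and 2. *)
Lemma rho_metric : is_metric rho.
Proof.
split.
- exact: rho_ge0.
- move=> x y; split => [|->]; last by rewrite /rho eqxx.
  by have [//|/rho_ge1 h h0] := eqVneq x y; move: h; rewrite h0 ler10.
- by move=> x y; rewrite /rho eq_sym orbC.
- move=> x y z; have [->|xy] := eqVneq x y; first by rewrite lerDr rho_ge0.
  have [->|yz] := eqVneq y z; first by rewrite lerDl rho_ge0.
  by have := rho_le2 x z; have := rho_ge1 xy; have := rho_ge1 yz; lra.
Qed.

Lemma ball_small x s : 0 < s -> s <= 1 -> mball rho x s = [set x].
Proof.
move=> s0 s1; apply/seteqP; split => y /=; last by move=> ->; rewrite /mball /= /rho eqxx.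
rewrite /mball /= => xys; apply/eqP; rewrite eq_sym; apply/negPn/negP => /rho_ge1.
by rewrite leNgt (lt_le_trans xys s1).
Qed.

Lemma ball_mid x s : 1 < s -> s <= 2 -> mball rho x s = star x.
Proof.
move=> s1 s2; apply/seteqP; split => y; rewrite /mball /star /= /rho.
  by case: ifP => //= _; case: ifP => //= _; rewrite ltNge s2.
case: ifP => //= _; first by move=> _; rewrite (lt_trans ltr01).
by move=> ->.
Qed.

Lemma ball_large x s : 2 < s -> mball rho x s = setT.
Proof.
move=> s2; apply/seteqP; split => y //= _.
by rewrite /mball /= (le_lt_trans (rho_le2 _ _)).
Qed.

(** Unit balls are points, so the topology is discrete and its Borel sets are all sets. *)
Lemma mopen_rho (A : set (node e)) : mopen rho A.
Proof.
move=> x Ax; exists 1; split => // y; rewrite ball_small// => /= -> //.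
Qed.

End Metric.

Section Measure.
Context {R : realType}.
Variable m : nat -> nat -> R.
Hypothesis m0 : forall N k, 0 < m N k.

(** The measure is a series of point masses indexed by the codes of the countable type [node e]; a
    number that codes no node gets mass 0. *)
Definition code_mass (n : nat) : {nonneg R} :=
  if pickle_inv n is Some x then NngNum (ltW (m0 (block x) (lev x))) else 0%:nng.

Definition code_node (n : nat) : node e := odflt root_node (pickle_inv n).

Definition node_measure : {measure set (node e) -> \bar R} :=
  mseries (fun n => mscale (code_mass n) (dirac (code_node n))) 0.

Local Notation mu := node_measure.

Lemma node_measure1 x : mu [set x] = (m (block x) (lev x))%:E.
Proof.
rewrite /node_measure /= /mseries (@nneseriesD1 _ _ (pickle x))//.
rewrite eseries0 ?adde0; last first.
  move=> k _ /= kx; transitivity ((code_mass k)%:num%:E * \d_(code_node k) [set x])%E.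
    by [].
  rewrite diracE /code_mass /code_node.
  have := @pickle_invK (node e) k.
  case: pickle_inv => [y|] /=; last by rewrite mul0e.
  move=> yk; rewrite memNset ?mule0// => /= yx.
  by move: kx; rewrite -yk yx eqxx.
transitivity ((code_mass (pickle x))%:num%:E *
    \d_(code_node (pickle x)) [set x] : \bar R)%E; first by [].
by rewrite diracE /code_mass /code_node pickleK_inv /= mem_set// mule1.
Qed.

Lemma level_measure N k (P : pred (node e)) : (k <= N)%N ->
  mu [set x | [/\ block x = N, lev x = k & P x]] =
  (m N k * #|[pred i : 'I_(2 ^ e k) | P (pt N k i)]|%:R)%:E.
Proof.
move=> kN; pose Q := [pred i : 'I_(2 ^ e k) | P (pt N k i)].
have -> : [set x | [/\ block x = N, lev x = k & P x]] =
    \big[setU/set0]_(i in Q) [set pt N k i].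
  rewrite -bigcup_pred; apply/seteqP; split => x /=.
    move=> [cx lx Px]; have ix := idx_lt x; rewrite lx in ix.
    have xE : x = pt N k (Ordinal ix) by rewrite /= -cx -lx ptK.
    by exists (Ordinal ix) => //=; rewrite inE -xE.
  by move=> [i /= Pi ->]; rewrite block_pt ?lev_pt.
rewrite measure_bigsetU_ord_cond//; last first.
  apply/trivIsetP => i j _ _ ij; apply/seteqP; split => x //= [-> /(congr1 idx)].
  by rewrite !idx_pt// => /val_inj /eqP; rewrite (negbTE ij).
rewrite (eq_bigr (fun=> (m N k)%:E)); last first.
  by move=> i _; apply: etrans (node_measure1 _) _; rewrite block_pt// lev_pt.
by rewrite sumEFin sumr_const mulr_natr.
Qed.

Lemma block_measure_le N (A : set (node e)) :
  (mu ([set x | block x = N] `&` A) <=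
   \sum_(k < N.+1) mu ([set x | block x = N /\ lev x = k] `&` A))%E.
Proof.
pose F k := [set x : node e | block x = N /\ lev x = k] `&` A.
apply: (@le_trans _ _ (mu (\big[setU/set0]_(k < N.+1) F k))); last exact: Boole_inequality.
apply: le_measure; rewrite ?inE// => x [/= cx Ax].
rewrite -bigcup_mkord; exists (lev x); last by [].
by rewrite /= ltnS -cx lev_le.
Qed.

End Measure.
End Points.

(** The range of i consists of a / b full periods, in each of which i %% b takes every residue once.
    It transfers counts on a level to counts of leaves below it. *)
Lemma card_modn (a b : nat) (P : pred nat) : (b %| a)%N ->
  #|[pred i : 'I_a | P (i %% b)%N]| = (a %/ b * #|[pred j : 'I_b | P j]|)%N.
Proof.
have cnt n (Q : pred nat) : #|[pred i : 'I_n | Q i]| = (\sum_(0 <= i < n) Q i)%N.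
  by rewrite -sum1_card big_mkcond big_mkord; apply: eq_bigr => i _; rewrite inE; case: (Q i).
have [->|b0] := posnP b.
  by rewrite dvd0n => /eqP ->; rewrite div0n mul0n; apply: eq_card0 => -[].
move=> /dvdnP[q ->]; rewrite mulnK// (cnt _ (fun i => P (i %% b)%N)) cnt.
elim: q => [|q IH]; first by rewrite mul0n big_geq.
rewrite mulSn (@big_cat_nat _ _ _ b)//= ?leq_addr// mulSn; congr (_ + _)%N.
  by apply: eq_big_nat => i /andP[_ ib]; rewrite modn_small.
rewrite -IH -{1}[b]add0n big_addn addKn.
by apply: eq_big_nat => i _; rewrite modnDr.
Qed.

Lemma powR_sum_le {R : realType} (a : R) (I : Type) (s : seq I) (x : I -> R) :
  0 < a <= 1 -> (forall i, 0 <= x i) ->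
  (\sum_(i <- s) x i) `^ a <= \sum_(i <- s) x i `^ a.
Proof.
move=> a01 x0; elim: s => [|i s IH].
  by rewrite !big_nil powR0// gt_eqF//; case/andP: a01.
rewrite !big_cons; apply: le_trans (lerD (lexx _) IH).
by apply: powRD_le => //; [case/andP: a01 => /ltW -> -> | exact: sumr_ge0].
Qed.

(** * The measure *)

Section Space.
Context {R : realType} (p : R) (e : nat -> nat) (w : nat -> R).
Hypothesis p1 : 1 < p.
Hypothesis ew : levels p e w.
Local Notation pos := (`]0%R, +oo[%classic : set R).

Let p0 : 0 < p. Proof. exact: lt_trans p1. Qed.
Let w0 k : 0 < w k. Proof. exact: level_gt0 ew k. Qed.
Let s0 N : 0 < scale w N. Proof. exact: scale_gt0 ew N. Qed.

Definition node_mass (N k : nat) : R := scale w N `^ p * w k.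

Lemma mass_gt0 N k : 0 < node_mass N k.
Proof. by rewrite mulr_gt0// powR_gt0. Qed.

Lemma mass_root N k : node_mass N k `^ p^-1 = scale w N * w k `^ p^-1.
Proof.
by rewrite /node_mass powRM ?powR_ge0 ?(ltW (w0 _))// -powRrM divff ?gt_eqF// powRr1 ?(ltW (s0 _)).
Qed.

Lemma mass_total N k : node_mass N k * (2 ^ e k)%:R = (scale w N * w k) `^ p.
Proof.
by rewrite /node_mass -mulrA [w k * _]mulrC (level_total ew) powRM ?ltW.
Qed.

Lemma mass_total_root N k : (node_mass N k * (2 ^ e k)%:R) `^ p^-1 = scale w N * w k.
Proof.
by rewrite mass_total -powRrM divff ?gt_eqF// powRr1// mulr_ge0 ?ltW.
Qed.

Local Notation mu := (node_measure e mass_gt0).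
Local Notation rho := (@rho e R).

Lemma mu1 x : mu [set x] = (node_mass (block x) (lev x))%:E.
Proof. exact: node_measure1. Qed.

Lemma mu_le (A B : set (node e)) : A `<=` B -> (mu A <= mu B)%E.
Proof. by move=> AB; apply: le_measure; rewrite ?inE. Qed.

Lemma mu_level N k : (k <= N)%N ->
  mu [set x | block x = N /\ lev x = k] = (node_mass N k * (2 ^ e k)%:R)%:E.
Proof.
move=> kN; have := @level_measure e R node_mass mass_gt0 N k xpredT kN.
have -> : #|[pred i : 'I_(2 ^ e k) | xpredT (pt e N k i)]| = (2 ^ e k)%N.
  by rewrite -[RHS]card_ord; apply: eq_card.
by move=> <-; congr (mu _); apply/seteqP; split => x /= [] // -> ->.
Qed.

Lemma mu_total_lty : (mu setT < +oo)%E.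
Proof.
(* Block N has mass at most 2^-(N+1): the root masses of its levels are at most 1, so the masses are
   no larger than the root masses, whose sum is at most 2 * 4^-(N+1). *)
apply: (@le_lt_trans _ _ (1 : R)%:E); last exact: ltry.
apply: (@le_trans _ _ (\sum_(0 <= N <oo) (1 / (2 ^ N.+1)%:R : R)%:E)%E); last first.
  exact: epsilon_trick0.
apply: (@le_trans _ _ (\sum_(0 <= N <oo) mu [set x | block x = N])%E).
  apply: measure_sigma_subadditive => //.
  by move=> x _; exists (block x).
apply: lee_nneseries => [N _ _|N _]; first exact: measure_ge0.
rewrite -[X in mu X]setIT; apply: le_trans (block_measure_le _ _ _) _.
rewrite (eq_bigr (fun k : 'I_N.+1 => (node_mass N k * (2 ^ e k)%:R)%:E)); last first.
  by move=> k _; rewrite setIT; apply: mu_level; exact: ltn_ord k.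
rewrite sumEFin lee_fin.
apply: (@le_trans _ _ (\sum_(k < N.+1) scale w N * w k)).
  apply: ler_sum => k _; rewrite mass_total ge1r_powR ?(ltW p1)// mulr_gt0//=.
  have sw : scale w N * w k <= scale w N * (2 * w N).
    rewrite ler_pM2l// (le_trans _ (sum_level_le p1 ew N))//.
    by rewrite (bigD1 k)//= lerDl sumr_ge0// => j _; rewrite ltW.
  have := scale_le ew N; have : 4^-1 ^+ N.+1 <= 4^-1 :> R.
    by rewrite exprS ler_piMr// exprn_ile1// invf_le1// ler1n.
  lra.
rewrite -mulr_sumr; have := sum_level_le p1 ew N.
rewrite -(ler_pM2l (s0 N)); have := scale_le ew N.
have -> : 1 / (2 ^ N.+1)%:R = 2^-1 ^+ N.+1 :> R by rewrite div1r natrX exprVn.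
have : 2 * 4^-1 ^+ N.+1 <= 2^-1 ^+ N.+1 :> R.
  have -> : 4^-1 = 2^-1 * 2^-1 :> R by rewrite -invfM -natrM.
  rewrite exprMn mulrA ler_piMl ?exprn_ge0 ?invr_ge0//.
  rewrite exprS mulrA divff ?mul1r// exprn_ile1 ?invr_ge0//.
  by rewrite invf_le1// ler1n.
lra.
Qed.

Lemma mu_lty A : (mu A < +oo)%E.
Proof. exact: le_lt_trans (mu_le (@subsetT _ A)) mu_total_lty. Qed.

Lemma mu_fin A : mu A \is a fin_num.
Proof. by rewrite ge0_fin_numE ?mu_lty. Qed.

Lemma mu_gt0 (A : set (node e)) x : A x -> (0 < mu A)%E.
Proof.
move=> Ax; apply: (@lt_le_trans _ _ (mu [set x])).
  by rewrite mu1 lte_fin mass_gt0.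
by apply: mu_le => y ->.
Qed.

Lemma space_mms : metric_measure_space rho mu.
Proof.
split; first by constructor; exact: root_node.
- exact: rho_metric.
- apply/seteqP; split => A _; last by [].
  apply: sub_sigma_algebra; exact: mopen_rho.
- move=> x s sp; rewrite mu_lty andbT; apply: (@mu_gt0 _ x).
  by rewrite /mball /= rhoxx.
Qed.

Lemma level_ge_nat N : N%:R <= w N.
Proof.
have := level_sparse ew N; have := level_root_le p1 ew N.
have : N%:R <= \sum_(k < N) w k.
  rewrite -[X in X%:R <= _]card_ord -sumr_const.
  by apply: ler_sum => k _; exact: level_ge1 ew k.
have : 0 <= N%:R :> R by []. have := ltW (w0 N). lra.
Qed.

(** Around a point on level 0 of block N, the open ball of radius 1 is that point, while the open
    ball of radius 2 contains a leaf. The ratio of masses is at least w_N / w_0, which is unbounded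
    in N. *)
Lemma space_nondoubling : ~ doubling rho mu.
Proof.
move=> [C HC].
have key N : w N <= C * w 0.
  have n0 k : (0 < 2 ^ e k)%N by rewrite expn_gt0.
  have := HC (pt e N 0 0) 1 ltr01; rewrite mulr1 ball_mid ?ltr1n// ball_small//.
  rewrite mu1 block_pt// lev_pt// => le1.
  have : ((node_mass N N)%:E <= C%:E * (node_mass N 0)%:E)%E.
    apply: le_trans le1.
    have -> : (node_mass N N)%:E = mu [set pt e N N 0] by rewrite mu1 block_pt// lev_pt.
    apply: mu_le => y /= ->; apply/or3P; apply: Or32.
    by rewrite /anc !block_pt// !lev_pt// !idx_pt// mod0n !eqxx.
  by rewrite -EFinM lee_fin /node_mass mulrCA ler_pM2l ?powR_gt0.
have := level_ge_nat (Num.trunc (C * w 0)).+1.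
have := key (Num.trunc (C * w 0)).+1; have := truncnS_gt (C * w 0); lra.
Qed.

End Space.

(** * Averages over balls *)

Section Averages.
Context {R : realType} (p : R) (e : nat -> nat) (w : nat -> R).
Hypothesis p1 : 1 < p.
Hypothesis ew : levels p e w.

Let p0 : 0 < p. Proof. exact: lt_trans p1. Qed.
Let w0 k : 0 < w k. Proof. exact: level_gt0 ew k. Qed.
Let s0 N : 0 < scale w N. Proof. exact: scale_gt0 ew N. Qed.
Let m0 N k : 0 < node_mass p w N k. Proof. exact: mass_gt0 ew N k. Qed.

Local Notation mu := (node_measure e (mass_gt0 ew)).
Local Notation rho := (@rho e R).
Local Notation mass := (node_mass p w).

Implicit Types (f : node e -> R) (B : set (node e)).

Definition avg f B : \bar R :=
  ((fine (mu B))^-1%:E * \int[mu]_(y in B) (`|f y|)%:E)%E.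

Lemma avg_gt f B t x : B x -> (t%:E < avg f B)%E -> exists2 y, B y & t < `|f y|.
Proof.
move=> Bx; apply: contraPP => nB; apply/negP; rewrite -leNgt.
have ft y : B y -> `|f y| <= t.
  by move=> By; rewrite leNgt; apply/negP => ty; apply: nB; exists y.
have Bp : 0 < fine (mu B) by rewrite fine_gt0// (mu_gt0 ew Bx) mu_lty.
have : (\int[mu]_(y in B) (`|f y|)%:E <= t%:E * mu B)%E.
  rewrite -integral_cst//; apply: ge0_integral_mono => y By; rewrite lee_fin//.
  exact: ft.
rewrite -[mu B in X in (_ <= X)%E -> _]fineK ?mu_fin// -EFinM => le1.
apply: (@le_trans _ _ ((fine (mu B))^-1%:E * (t * fine (mu B))%:E)%E).
  by apply: lee_wpmul2l => //; rewrite lee_fin invr_ge0 ltW.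
by rewrite -EFinM lee_fin mulrC mulfK ?gt_eqF.
Qed.

Definition path_node N i k : node e := pt e N k (i %% 2 ^ e k).

Lemma path_node_lt i k : (i %% 2 ^ e k < 2 ^ e k)%N.
Proof. by rewrite ltn_mod expn_gt0. Qed.

Lemma star_path x : leaf x ->
  star x = \big[setU/set0]_(k < (block x).+1) [set path_node (block x) (idx x) k].
Proof.
move=> lx; rewrite star_leaf//.
rewrite -(bigcup_mkord (block x).+1 (fun k => [set path_node (block x) (idx x) k])).
apply/seteqP; split => y /=.
  move=> /and3P[/eqP byx _ /eqP iy]; exists (lev y).
    by rewrite /= ltnS -byx lev_le.
  by rewrite /path_node -iy -byx ptK.
move=> [k /= kN ->]; rewrite ltnS in kN; rewrite /path_node /anc.
by rewrite block_pt ?lev_pt ?idx_pt ?path_node_lt// eqxx -/(leaf x) lx eqxx.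
Qed.

Lemma path_node_trivIset N i (A : set nat) : (forall k, A k -> (k <= N)%N) ->
  trivIset A (fun k => [set path_node N i k]).
Proof.
move=> AN; apply/trivIsetP => j k Aj Ak jk; apply/seteqP; split => y //= [-> /(congr1 (@lev e))].
by rewrite !lev_pt ?path_node_lt ?AN// => /eqP; rewrite (negbTE jk).
Qed.

Lemma integral_node f x :
  (\int[mu]_(y in [set x]) (`|f y|)%:E = (mass (block x) (lev x) * `|f x|)%:E)%E.
Proof.
rewrite (eq_integral (cst (`|f x|)%:E)); last by move=> y; rewrite inE => ->.
by rewrite integral_cst// mu1 -EFinM mulrC.
Qed.

Lemma integral_star f x : leaf x ->
  (\int[mu]_(y in star x) (`|f y|)%:E =
   (\sum_(k < (block x).+1) mass (block x) k * `|f (path_node (block x) (idx x) k)|)%:E)%E.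
Proof.
move=> lx; rewrite star_path// -(big_mkord xpredT (fun k => [set path_node _ _ k])).
rewrite ge0_integral_bigsetU//=.
- rewrite big_mkord -sumEFin; apply: eq_bigr => k _; rewrite integral_node.
  by rewrite /path_node block_pt ?lev_pt ?path_node_lt// -ltnS.
- exact: (iota_uniq 0 (block x).+1).
- by apply: path_node_trivIset => k; rewrite /= mem_index_iota.
Qed.

Lemma mu_star x : leaf x -> mu (star x) = (\sum_(k < (block x).+1) mass (block x) k)%:E.
Proof.
move=> lx; have := integral_star (fun=> 1) lx.
under eq_integral do rewrite normr1.
rewrite integral_cst// mul1e => ->; congr (_%:E).
by apply: eq_bigr => k _; rewrite normr1 mulr1.
Qed.

(** This is A |f| at the i-th leaf of block N: the average over the star of the leaf, with the mass
    of the star replaced by that of the leaf. *)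
Definition path_sum f N i : R := \sum_(k < N.+1) w k / w N * `|f (path_node N i k)|.

Lemma path_sum_ge f x : leaf x -> `|f x| <= path_sum f (block x) (idx x).
Proof.
move=> lx; rewrite /path_sum big_ord_recr /= divff ?gt_eqF// mul1r.
have -> : path_node (block x) (idx x) (block x) = x.
  rewrite /path_node modn_small -(eqP lx) ?idx_lt//.
  by move: (ptK x); rewrite -(eqP lx).
by rewrite lerDr sumr_ge0// => k _; rewrite mulr_ge0// divr_ge0 ?ltW.
Qed.

Lemma avg_star_le f x : leaf x -> (avg f (star x) <= (path_sum f (block x) (idx x))%:E)%E.
Proof.
move=> lx; rewrite /avg integral_star// -EFinM lee_fin.
set N := block x; set i := idx x.
have mx : mass N N <= fine (mu (star x)).
  rewrite mu_star//= big_ord_recr /= lerDr sumr_ge0// => k _; exact: ltW.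
rewrite mulr_sumr; apply: ler_sum => k _.
rewrite mulrA ler_wpM2r//.
apply: (@le_trans _ _ ((mass N N)^-1 * mass N k)).
  by rewrite ler_pM2r// lef_pV2 ?posrE// (lt_le_trans _ mx).
rewrite /node_mass [leLHS](_ : _ = w k / w N)//.
by field; rewrite !gt_eqF// powR_gt0.
Qed.

(** The star of a leaf weighs at most twice the leaf, because w_0 + ... + w_N <= 2 w_N. *)
Lemma avg_star_ge f x : leaf x ->
  (((\sum_(k < (block x).+1) mass (block x) k * `|f (path_node (block x) (idx x) k)|) /
    (2 * mass (block x) (block x)))%:E <= avg f (star x))%E.
Proof.
move=> lx; rewrite /avg integral_star// -EFinM lee_fin mulrC ler_wpM2r//.
  by apply: sumr_ge0 => k _; rewrite mulr_ge0// ltW.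
have mE : fine (mu (star x)) = scale w (block x) `^ p * \sum_(k < (block x).+1) w k.
  by rewrite mu_star//= mulr_sumr.
have mx : 0 < fine (mu (star x)).
  have sx : star x x by rewrite /star /= eqxx.
  by rewrite fine_gt0// (mu_gt0 ew sx) mu_lty.
rewrite lef_pV2 ?posrE//; last exact: mulr_gt0.
rewrite mE /node_mass mulrCA ler_pM2l ?powR_gt0//.
exact: (sum_level_le p1 ew (block x)).
Qed.

Lemma maxfun_ge f x : (avg f (star x) <= maxfun rho mu f x)%E.
Proof.
apply: ereal_sup_ubound; exists 2; first by rewrite /= ltr0n.
by rewrite ball_mid// ltr1n.
Qed.

Definition excess f N (t : R) : set (node e) := [set x | block x = N] `&`
  [set x | (leaf x -> t < path_sum f N (idx x)) /\
           exists i : 'I_(2 ^ e N), t < path_sum f N i].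

(** The cases follow the three kinds of balls. Around an internal node x, the star contains besides
    x only leaves of the same block, and at a leaf |f| is at most its path sum; this is why [excess]
    takes in the internal nodes once some leaf exceeds t. *)
Lemma maxfun_gt f t x : 0 <= t -> (t%:E < maxfun rho mu f x)%E ->
  [\/ t < `|f x|, (t%:E < avg f setT)%E | excess f (block x) t x].
Proof.
move=> t0 /ereal_sup_gt[_ [s s_gt0 <-]]; rewrite -/(avg f _).
have self : star x x by rewrite /star /= eqxx.
have [s1|s1] := leP s 1.
  by rewrite ball_small// => /(avg_gt (erefl : [set x] x))[y /= ->]; exact: Or31.
have [s2|s2] := leP s 2; last by rewrite ball_large//; exact: Or32.
rewrite ball_mid//; have [lx|nlx] := boolP (leaf x).
  move=> /lt_le_trans/(_ (avg_star_le f lx)); rewrite lte_fin => tp.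
  apply: Or33; split => //; split => //.
  have ix : (idx x < 2 ^ e (block x))%N by rewrite -(eqP lx) idx_lt.
  by exists (Ordinal ix).
move=> /(avg_gt self)[y sxy ty].
have [yx|yx] := eqVneq y x; first by apply: Or31; rewrite -yx.
apply: Or33; split => //; split; first by rewrite (negbTE nlx).
case/or3P: sxy => [/eqP xy|/and3P[/eqP bxy ly _]|/and3P[_ lx _]].
- by rewrite xy eqxx in yx.
- have iy : (idx y < 2 ^ e (block x))%N by rewrite bxy -(eqP ly) idx_lt.
  by exists (Ordinal iy); rewrite (lt_le_trans ty)//= bxy path_sum_ge.
- by rewrite /leaf lx in nlx.
Qed.

Definition leaf_count f N (t : R) : R :=
  #|[pred i : 'I_(2 ^ e N) | t < path_sum f N i]|%:R.

(* The internal nodes of a block weigh less than a single leaf, so the sup over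
   the leaves is an admissible bound for the maximal function there. *)
Lemma excess_root f N t :
  (poweR (mu (excess f N t)) p^-1 <=
   (2 * (mass N N `^ p^-1 * leaf_count f N t `^ p^-1))%:E)%E.
Proof.
have ip01 : 0 < p^-1 <= 1 by rewrite invr_gt0 p0 invf_le1// ltW.
have [c0|c0] := posnP #|[pred i : 'I_(2 ^ e N) | t < path_sum f N i]|.
  have -> : excess f N t = set0.
    apply/seteqP; split => x // [_ [_ [i ti]]].
    by have := card0_eq c0 i; rewrite inE ti.
  by rewrite measure0 poweR0r ?lee_fin ?mulr_ge0 ?powR_ge0// gt_eqF// invr_gt0.
have c1 : 1 <= leaf_count f N t by rewrite ler1n.
have le1 : (mu (excess f N t) <=
    (\sum_(k < N) mass N k * (2 ^ e k)%:R + mass N N * leaf_count f N t)%:E)%E.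
  apply: le_trans (block_measure_le _ _ _) _.
  rewrite big_ord_recr /= EFinD -sumEFin; apply: leeD.
    apply: lee_sum => k _; rewrite -(mu_level ew (ltnW (ltn_ord k))).
    by apply: mu_le => x [].
  rewrite /leaf_count.
  have := @level_measure e R mass (mass_gt0 ew) N N
    (fun x => t < path_sum f N (idx x)) (leqnn N).
  have -> : #|[pred i : 'I_(2 ^ e N) | t < path_sum f N (idx (pt e N N i))]| =
      #|[pred i : 'I_(2 ^ e N) | t < path_sum f N i]|.
    by apply: eq_card => i; rewrite !inE idx_pt.
  move=> <-; apply: mu_le => x [[bx lx] [h _]]; split => //.
  by apply: h; rewrite /leaf bx lx.
apply: le_trans (le_poweR2r _ _ le1) _ => //; first by rewrite invr_ge0 ltW.
have ms0 k : 0 <= mass N k * (2 ^ e k)%:R by rewrite mulr_ge0// ltW.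
rewrite poweR_EFin lee_fin; apply: le_trans (powRD_le _ _ _) _.
- by case/andP: ip01 => /ltW -> ->.
- by apply: sumr_ge0 => k _.
- by rewrite mulr_ge0// ltW.
have := powR_sum_le (index_enum 'I_N) ip01 (fun k : 'I_N => ms0 k).
have -> : \sum_(k < N) (mass N k * (2 ^ e k)%:R) `^ p^-1 = scale w N * \sum_(k < N) w k.
  by rewrite mulr_sumr; apply: eq_bigr => k _; rewrite (mass_total_root p1 ew).
rewrite powRM// ?(ltW (m0 _ _))// => sum_le.
(* The internal levels add at most half the root mass of one leaf, and at least one leaf is counted;
   the resulting 3/2 is rounded up to 2. *)
have : scale w N * \sum_(k < N) w k <= scale w N * (w N `^ p^-1 / 2).
  by rewrite ler_pM2l//; exact: level_sparse ew N.
have mle : mass N N `^ p^-1 <= mass N N `^ p^-1 * leaf_count f N t `^ p^-1.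
  rewrite ler_peMr ?powR_ge0// -[leLHS](powRr0 (leaf_count f N t)).
  by rewrite ler_powR// invr_ge0 ltW.
have := mass_root p1 ew N N; have := powR_ge0 (mass N N) p^-1; lra.
Qed.

End Averages.

(** * Boundedness on L^{p,1} *)

Section Upper.
Context {R : realType} (p : R) (e : nat -> nat) (w : nat -> R).
Hypothesis p1 : 1 < p.
Hypothesis ew : levels p e w.
Local Notation pos := (`]0%R, +oo[%classic : set R).

Let p0 : 0 < p. Proof. exact: lt_trans p1. Qed.
Let p1' : 1 <= p. Proof. exact: ltW. Qed.
Let ip01 : 0 < p^-1 <= 1. Proof. by rewrite invr_gt0 p0 invf_le1// ltW. Qed.
Let ip0 : 0 <= p^-1. Proof. by case/andP: ip01 => /ltW. Qed.
Let w0 k : 0 < w k. Proof. exact: level_gt0 ew k. Qed.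
Let s0 N : 0 < scale w N. Proof. exact: scale_gt0 ew N. Qed.
Let m0 N k : 0 < node_mass p w N k. Proof. exact: mass_gt0 ew N k. Qed.

Local Notation mu := (node_measure e (mass_gt0 ew)).
Local Notation rho := (@rho e R).
Local Notation mass := (node_mass p w).

Implicit Types (f : node e -> R).

Lemma distribE (g : node e -> \bar R) t :
  distrib mu g t = mu [set x | (t%:E < g x)%E].
Proof. exact: outer_muE. Qed.

Definition level_count f N k (t : R) : R :=
  #|[pred j : 'I_(2 ^ e k) | t < `|f (pt e N k j)|]|%:R.

Definition level_root f N k t : R := (mass N k * level_count f N k t) `^ p^-1.

Lemma level_root_ge0 f N k t : 0 <= level_root f N k t.
Proof. exact: powR_ge0. Qed.

Lemma level_count_ni f N k s t : s <= t -> level_count f N k t <= level_count f N k s.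
Proof.
move=> st; rewrite ler_nat; apply: subset_leq_card; apply/fintype.subsetP => i.
by rewrite !inE; exact: le_lt_trans.
Qed.

Lemma level_root_ni f N k s t : s <= t -> level_root f N k t <= level_root f N k s.
Proof.
move=> st; apply: ge0_ler_powR => //; rewrite ?nnegrE.
- by rewrite mulr_ge0// ltW.
- by rewrite mulr_ge0// ltW.
- by rewrite ler_pM2l// level_count_ni.
Qed.

Lemma distrib_root_fin (g : node e -> \bar R) t : distrib_root mu p g t \is a fin_num.
Proof. by rewrite fin_num_poweR// distribE mu_fin. Qed.

Lemma level_root_le_distrib f N k t : (k <= N)%N ->
  ((level_root f N k t)%:E <= distrib_root mu p (absE f) t)%E.
Proof.
move=> kN; rewrite /distrib_root distribE -poweR_EFin.
apply: le_poweR2r => //; first by rewrite lee_fin mulr_ge0// ltW.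
have := @level_measure e R mass (mass_gt0 ew) N k (fun x => t < `|f x|) kN.
move=> <-; apply: mu_le => x [_ _ tx] /=.
by rewrite /absE lte_fin.
Qed.

(** An instance of [sum_levels_le] for fixed t: the superlevel set on a level is at most the whole
    level, and it contains at least one point unless it is empty. *)
Lemma sum_level_root_le f t :
  (\sum_(0 <= N <oo) (\sum_(k < N.+1) level_root f N k t)%:E <=
   4%:E * distrib_root mu p (absE f) t)%E.
Proof.
apply: lime_le.
  apply: is_cvg_nneseries => N _ _; rewrite lee_fin sumr_ge0// => k _.
  exact: level_root_ge0.
apply: nearW => M; rewrite sumEFin -[distrib_root _ _ _ _]fineK ?distrib_root_fin//.
rewrite -EFinM lee_fin.
have le_d N k : (k <= N)%N ->
    level_root f N k t <= fine (distrib_root mu p (absE f) t).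
  by move=> kN; rewrite -lee_fin fineK ?distrib_root_fin// level_root_le_distrib.
apply: (@sum_levels_le _ _ p1 _ _ ew (fun N k => level_root f N k t)) => //.
- by rewrite fine_ge0// poweR_ge0.
- move=> N k kN; rewrite level_root_ge0/= -(mass_total_root p1 ew).
  apply: ge0_ler_powR => //.
  + by rewrite nnegrE mulr_ge0// ltW.
  + by rewrite nnegrE mulr_ge0// ltW.
  + rewrite ler_pM2l// ler_nat -[leqRHS]card_ord; exact: max_card.
- move=> N k kN.
  have [c0|c0] := posnP #|[pred j : 'I_(2 ^ e k) | t < `|f (pt e N k j)|]|.
    left; rewrite /level_root /level_count c0 mulr0 powR0// gt_eqF//.
    by case/andP: ip01.
  right; rewrite -(mass_root p1 ew); apply: ge0_ler_powR => //.
  + by rewrite nnegrE ltW.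
  + by rewrite nnegrE mulr_ge0// ltW.
  + by rewrite ler_peMr ?(ltW (m0 _ _))// ler1n.
Qed.

Lemma measurable_level_root f N k (D : set R) : measurable D ->
  measurable_fun D (fun t => (level_root f N k t)%:E).
Proof.
move=> mD; apply: nonincreasing_emeasurable => // s t st.
by rewrite lee_fin level_root_ni.
Qed.

(** Minkowski's inequality separates the levels. The part of A f coming from level k repeats each
    value at n_N / n_k leaves, and the coefficient w_k / w_N exactly compensates for the change of
    mass. *)
Lemma leaf_root_integral_le f N :
  (\int[lebesgue_measure]_(t in pos)
     (mass N N `^ p^-1 * leaf_count w f N t `^ p^-1)%:E <=
   p%:E * \int[lebesgue_measure]_(t in pos) (\sum_(k < N.+1) level_root f N k t)%:E)%E.
Proof.
have mN : 0 <= mass N N `^ p^-1 by exact: powR_ge0.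
under eq_integral do rewrite EFinM.
rewrite ge0_integralZl_EFin//; last 2 first.
- by move=> t _; rewrite lee_fin powR_ge0.
- apply: nonincreasing_emeasurable => // s t st.
  by rewrite lee_fin powR_count_ni.
have c0 (k : 'I_N.+1) : 0 <= w k / w N by rewrite divr_ge0// ltW.
have := @count_minkowski R 'I_(2 ^ e N) p p1 'I_N.+1 (index_enum _)
  (fun k => w k / w N) (fun k i => `|f (path_node e N i k)|) c0 (fun _ _ => normr_ge0 _).
rewrite -(lee_pmul2l (x := (mass N N `^ p^-1)%:E))// ?lte_fin ?powR_gt0// => h.
apply: le_trans h _.
under [X in (_ <= p%:E * X)%E]eq_integral do rewrite -sumEFin.
rewrite ge0_integral_sum//; last 2 first.
- by move=> k; exact: measurable_level_root.
- by move=> k t _; rewrite lee_fin level_root_ge0.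
rewrite !ge0_sume_distrr//; last 2 first.
- by move=> k _; apply: integral_ge0 => t _; rewrite lee_fin level_root_ge0.
- move=> k _; apply: mule_ge0; first by rewrite lee_fin mulr_ge0// ltW.
  by apply: integral_ge0 => t _; rewrite lee_fin powR_ge0.
apply: lee_sum => k _; rewrite EFinM -muleA muleCA; apply: lee_wpmul2l.
  by rewrite lee_fin ltW.
rewrite muleA -EFinM -ge0_integralZl_EFin//; last 2 first.
- apply: nonincreasing_emeasurable => // s t st.
  by rewrite lee_fin powR_count_ni.
- by rewrite mulr_ge0.
apply: ge0_integral_mono => t _; first by rewrite -EFinM lee_fin mulr_ge0 ?powR_ge0// mulr_ge0.
rewrite -EFinM lee_fin /level_root /level_count.
have kN : (k <= N)%N by rewrite -ltnS.
have ekN : (e k <= e N)%N by exact: level_homo ew _ _ kN.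
have -> : #|[pred i : 'I_(2 ^ e N) | t < `|f (path_node e N i k)|]| =
    (2 ^ e N %/ 2 ^ e k * #|[pred j : 'I_(2 ^ e k) | (t < `|f (pt e N k j)|)%R]|)%N.
  rewrite -(card_modn (fun i => t < `|f (pt e N k i)|))//.
  by rewrite dvdn_exp2l.
rewrite natrM; set q := (2 ^ e N %/ 2 ^ e k)%N%:R.
have qE : q * (2 ^ e k)%:R = (2 ^ e N)%:R :> R by rewrite -natrM divnK// dvdn_exp2l.
have n0 j : (0 : R) < (2 ^ e j)%:R by rewrite ltr0n expn_gt0.
rewrite powRM// mulrA powRM ?(ltW (m0 _ _))// ler_wpM2r ?powR_ge0//.
have sk : 0 < scale w N * w k by rewrite mulr_gt0.
(* After multiplication by n_k^(1/p), both sides equal [scale w N * w k]. *)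
suff -> : mass N N `^ p^-1 * (w k / w N) * q `^ p^-1 = mass N k `^ p^-1 by [].
apply: (@mulIf _ ((2 ^ e k)%:R `^ p^-1)); first by rewrite gt_eqF// powR_gt0.
rewrite -[in RHS]powRM ?(ltW (m0 _ _)) ?(ltW (n0 _))// (mass_total_root p1 ew).
rewrite -[LHS]mulrA -[in LHS]powRM ?ler0n// qE mulrAC -powRM ?(ltW (m0 _ _)) ?(ltW (n0 _))//.
by rewrite (mass_total_root p1 ew); field; rewrite gt_eqF.
Qed.

(** Handles the balls equal to the whole space. By the layer cake formula, the integral of |f| is
    that of mu(|f| > t), and mu(|f| > t) <= V^(1 - 1/p) mu(|f| > t)^(1/p), where V is the total
    mass. *)
Lemma avg_total_le f : (root_integral mu p (absE f) < +oo)%E ->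
  exists a : R, [/\ 0 <= a, avg ew f setT = a%:E &
    ((fine (mu setT) `^ p^-1 * a)%:E <= root_integral mu p (absE f))%E].
Proof.
move=> Kfin; set K := root_integral _ _ _ in Kfin *.
set V := fine (mu setT).
have V0 : 0 < V by rewrite fine_gt0// (mu_gt0 ew (x := root_node e))// mu_lty.
have le1 : (\int[mu]_y (`|f y|)%:E <= (V `^ (1 - p^-1))%:E * K)%E.
  apply: (@le_trans _ _ (\int[lebesgue_measure]_(t in pos) mu [set y | (t < `|f y|)%R])%E).
    rewrite le_eqVlt; apply/orP; left; apply/eqP.
    exact: (@layer_cake R _ (node e) (@code_mass e R mass (mass_gt0 ew)) (@code_node e)
      (fun y => `|f y|) (@measurable_node e) (fun y => normr_ge0 (f y))).
  rewrite -ge0_integralZl_EFin ?powR_ge0//; last 2 first.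
  - by move=> t _; exact: distrib_root_ge0.
  - exact: measurable_distrib_root.
  apply: ge0_integral_mono => t _; first exact: measure_ge0.
  rewrite /distrib_root distribE; pose A : set (node e) := [set y | t < `|f y|].
  have -> : [set y | (t%:E < absE f y)%E] = A.
    by apply/seteqP; split => x; rewrite /A /= /absE lte_fin.
  rewrite -/A.
  have AV : fine (mu A) <= V by rewrite fine_le ?mu_fin// mu_le.
  rewrite -[mu A]fineK ?mu_fin// poweR_EFin -EFinM lee_fin.
  have A0 : 0 <= fine (mu A) by rewrite fine_ge0.
  rewrite -[leLHS]powRr1// -{1}[1](subrK p^-1) powRD; last first.
    by rewrite subrK oner_eq0.
  rewrite ler_wpM2r ?powR_ge0// ge0_ler_powR ?nnegrE ?(ltW V0)//.
  by rewrite subr_ge0; case/andP: ip01.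
have Ifin : (\int[mu]_y (`|f y|)%:E)%E \is a fin_num.
  rewrite ge0_fin_numE; last by apply: integral_ge0 => y _; rewrite lee_fin.
  apply: le_lt_trans le1 _; rewrite lte_mul_pinfty// lee_fin; exact: powR_ge0.
set J := fine (\int[mu]_y (`|f y|)%:E)%E.
have JE : (\int[mu]_y (`|f y|)%:E = J%:E)%E by rewrite fineK.
have J0 : 0 <= J by rewrite fine_ge0// integral_ge0// => y _; rewrite lee_fin.
exists (V^-1 * J); split.
- by rewrite mulr_ge0// invr_ge0 ltW.
- by rewrite /avg JE EFinM.
have Kf : K \is a fin_num by rewrite ge0_fin_numE// root_integral_ge0.
move: le1; rewrite JE -[in X in (X -> _)](fineK Kf) -[K in X in _ -> X](fineK Kf).
rewrite -EFinM !lee_fin => le1.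
rewrite mulrA -(ler_pM2l (powR_gt0 (1 - p^-1) V0)).
rewrite [leLHS](_ : _ = J)// !mulrA -powRD ?subrK ?oner_eq0// powRr1 ?(ltW V0)//.
by rewrite divff ?mul1r// gt_eqF.
Qed.

Lemma maxfun_root_integral_le f : (root_integral mu p (absE f) < +oo)%E ->
  (root_integral mu p (maxfun rho mu f) <=
   (2 + 8 * p)%:E * root_integral mu p (absE f))%E.
Proof.
move=> Kfin; have [a [a0 aE aK]] := avg_total_le Kfin.
set K := root_integral mu p (absE f) in Kfin aK *.
set V := fine (mu setT) in aK *.
have V0 : 0 <= V by rewrite fine_ge0.
pose g N t := (2 * (mass N N `^ p^-1 * leaf_count w f N t `^ p^-1))%:E.
have g0 N t : (0 <= g N t)%E by rewrite lee_fin !mulr_ge0 ?powR_ge0.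
have mg N : measurable_fun pos (g N).
  apply: nonincreasing_emeasurable => // s t st.
  by rewrite lee_fin ler_pM2l// ler_pM2l ?powR_gt0// powR_count_ni.
(* The p-th root of the distribution function of the constant a, the average of |f| over the whole
   space. *)
pose h (t : R) := (V `^ p^-1 * (t < a)%R%:R)%:E.
have h0 t : (0 <= h t)%E by rewrite lee_fin mulr_ge0 ?powR_ge0.
have mh : measurable_fun pos h.
  apply: nonincreasing_emeasurable => // s t st.
  rewrite lee_fin ler_wpM2l ?powR_ge0// ler_nat.
  by case: (ltP t) => // ta; rewrite (le_lt_trans st ta).
have pointwise t : 0 < t -> (distrib_root mu p (maxfun rho mu f) t <=
    distrib_root mu p (absE f) t + h t + \sum_(0 <= N <oo) g N t)%E.
  move=> t0; pose A := [set x | (t%:E < absE f x)%E].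
  pose B : set (node e) := if (t < a)%R then setT else set0.
  pose C := \bigcup_N excess w f N t.
  have sub : [set x | (t%:E < maxfun rho mu f x)%E] `<=` A `|` B `|` C.
    move=> x /= /(maxfun_gt p1 (ltW t0))[tf|ta|ex].
    - by left; left; rewrite /A /= /absE lte_fin.
    - by left; right; rewrite /B; rewrite aE lte_fin in ta; rewrite ta.
    - by right; exists (block x).
  rewrite /distrib_root !distribE.
  apply: (@le_trans _ _ (poweR (mu A + mu B + mu C) p^-1)).
    apply: le_poweR2r => //; apply: (le_trans (mu_le ew sub)).
    by apply: (le_trans (measureU2 _ _ _)) => //; rewrite leeD2r// measureU2.
  apply: le_trans (poweRD_le _ _ _) _ => //; first by rewrite adde_ge0.
  apply: leeD.
    apply: le_trans (poweRD_le _ _ _) _ => //; apply: leeD2l.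
    rewrite /B /h; case: ifPn => _; last first.
      by rewrite measure0 poweR0r ?mulr0// gt_eqF//; case/andP: ip01.
    by rewrite -[mu setT]fineK ?mu_fin// poweR_EFin mulr1.
  apply: (@le_trans _ _ (poweR (\sum_(0 <= N <oo) mu (excess w f N t)) p^-1)).
    by apply: le_poweR2r => //; exact: generalized_Boole_inequality.
  apply: le_trans (poweR_nneseries_le _ _) _ => //.
  apply: lee_nneseries => [N _ _|N _]; first exact: poweR_ge0.
  exact: excess_root.
have K0 : (0 <= K)%E by exact: root_integral_ge0.
(* The terms come from |f| itself, from the whole space and from the stars. The constant of the
   stars is 2 from [excess_root], times p from Minkowski, times 4 from [sum_level_root_le]. *)
apply: (@le_trans _ _ (K + K + (8 * p)%:E * K)%E); last first.
  have Kf : K \is a fin_num by rewrite ge0_fin_numE.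
  rewrite -(fineK Kf) -!EFinM -!EFinD lee_fin le_eqVlt; apply/orP; left.
  by apply/eqP; ring.
apply: (@le_trans _ _ (\int[lebesgue_measure]_(t in pos)
    (distrib_root mu p (absE f) t + h t + \sum_(0 <= N <oo) g N t)))%E.
  apply: ge0_integral_mono => t; rewrite /= in_itv /= andbT => t0.
    exact: distrib_root_ge0.
  exact: pointwise.
rewrite ge0_integralD//; last 4 first.
- by move=> t _; rewrite adde_ge0// distrib_root_ge0.
- by apply: emeasurable_funD => //; exact: measurable_distrib_root.
- by move=> t _; exact: nneseries_ge0.
- apply: nonincreasing_emeasurable => // s t st.
  apply: lee_nneseries => [N _ _|N _]; first exact: g0.
  by rewrite lee_fin ler_pM2l// ler_pM2l ?powR_gt0// powR_count_ni.
rewrite ge0_integralD//; last 2 first.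
- by move=> t _; exact: distrib_root_ge0.
- exact: measurable_distrib_root.
apply: leeD.
  apply: leeD2l; apply: le_trans aK.
  have := @integral_step R nat [:: 0%N] (fun _ => V `^ p^-1) (fun _ => a).
  rewrite big_seq1 => <-//; last by move=> _; exact: powR_ge0.
  by rewrite le_eqVlt; apply/orP; left; apply/eqP; apply: eq_integral => t _; rewrite big_seq1.
rewrite integral_nneseries//.
apply: (@le_trans _ _ (\sum_(0 <= N <oo) (2 * p)%:E *
   \int[lebesgue_measure]_(t in pos) (\sum_(k < N.+1) level_root f N k t)%:E)%E).
  apply: lee_nneseries => [N _ _|N _]; first by apply: integral_ge0 => t _.
  rewrite /g; under eq_integral do rewrite EFinM.
  rewrite ge0_integralZl_EFin//; last 2 first.
  - by move=> t _; rewrite lee_fin mulr_ge0 ?powR_ge0.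
  - apply: nonincreasing_emeasurable => // s t st.
    by rewrite lee_fin ler_pM2l ?powR_gt0// powR_count_ni.
  by rewrite EFinM -muleA; apply: lee_wpmul2l => //; exact: leaf_root_integral_le.
have lr0 N t : (0 <= (\sum_(k < N.+1) level_root f N k t)%:E)%E.
  by rewrite lee_fin sumr_ge0// => k _; exact: level_root_ge0.
rewrite nneseriesZl; last by move=> N _; apply: integral_ge0 => t _.
rewrite -integral_nneseries//; last first.
  move=> N; apply: nonincreasing_emeasurable => // s t st.
  by rewrite lee_fin; apply: ler_sum => k _; exact: level_root_ni.
have -> : (8 * p)%:E = ((2 * p)%:E * 4%:E)%E :> \bar R.
  by rewrite -EFinM; congr (_%:E); ring.
rewrite -muleA; apply: lee_wpmul2l; first by rewrite lee_fin mulr_ge0// ltW.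
rewrite -ge0_integralZl_EFin//; last 2 first.
- by move=> t _; exact: distrib_root_ge0.
- exact: measurable_distrib_root.
apply: ge0_integral_mono => t _; first exact: nneseries_ge0.
exact: sum_level_root_le.
Qed.

Lemma maxconst1_lty r : (1 <= r)%E -> (maxconst rho mu p 1%E r < +oo)%E.
Proof.
move=> r1; apply: (@le_lt_trans _ _ (2 + 8 * p)%:E); last exact: ltry.
apply: ereal_inf_lbound; exists (2 + 8 * p) => //; split.
  by rewrite addr_ge0// mulr_ge0// ltW.
move=> f [_]; rewrite lorentz1E// => Kp.
have Kfin : (root_integral mu p (absE f) < +oo)%E.
  move: Kp; rewrite !ltey; apply: contra => /eqP ->.
  by rewrite gt0_muley ?lte_fin.
apply: le_trans (lorentz_le_lorentz1 mu p1' _ r1) _.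
rewrite lorentz1E// muleCA; apply: lee_wpmul2l; first by rewrite lee_fin ltW.
exact: maxfun_root_integral_le.
Qed.

End Upper.

(** * Unboundedness on L^{p,q} for q > 1 *)

Section Lower.
Context {R : realType} (p : R) (e : nat -> nat) (w : nat -> R).
Hypothesis p1 : 1 < p.
Hypothesis ew : levels p e w.
Local Notation pos := (`]0%R, +oo[%classic : set R).

Let p0 : 0 < p. Proof. exact: lt_trans p1. Qed.
Let p1' : 1 <= p. Proof. exact: ltW. Qed.
Let ip01 : 0 < p^-1 <= 1. Proof. by rewrite invr_gt0 p0 invf_le1// ltW. Qed.
Let ip0 : 0 <= p^-1. Proof. by case/andP: ip01 => /ltW. Qed.
Let w0 k : 0 < w k. Proof. exact: level_gt0 ew k. Qed.
Let s0 N : 0 < scale w N. Proof. exact: scale_gt0 ew N. Qed.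
Let m0 N k : 0 < node_mass p w N k. Proof. exact: mass_gt0 ew N k. Qed.

Local Notation mu := (node_measure e (mass_gt0 ew)).
Local Notation rho := (@rho e R).
Local Notation mass := (node_mass p w).

(* All levels contribute equally to the averages over the stars of the leaves. *)
Definition test_fun N (x : node e) : R :=
  if (block x == N) && (lev x < N)%N then (w (lev x))^-1 else 0.

Lemma test_fun_ge0 N x : 0 <= test_fun N x.
Proof. by rewrite /test_fun; case: ifP => // _; rewrite invr_ge0 ltW. Qed.

(** Each level k < N contributes [mass N k / w k = scale w N ^ p] to the integral over the star, and
    the leaf contributes 0. *)
Lemma test_fun_maxfun N i : (i < 2 ^ e N)%N ->
  ((N%:R / (2 * w N))%:E <= maxfun rho mu (test_fun N) (pt e N N i))%E.
Proof.
move=> iN; apply: le_trans (maxfun_ge ew _ _).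
have lx : leaf (pt e N N i) by rewrite /leaf block_pt ?lev_pt.
apply: le_trans (avg_star_ge p1 ew _ lx); rewrite block_pt// idx_pt//.
rewrite lee_fin big_ord_recr /=.
rewrite (eq_bigr (fun=> scale w N `^ p)); last first.
  move=> k _; have kN : (k <= N)%N by exact: ltnW (ltn_ord k).
  rewrite /test_fun /path_node block_pt ?lev_pt ?path_node_lt// eqxx ltn_ord /=.
  by rewrite ger0_norm ?invr_ge0 ?(ltW (w0 _))// /node_mass mulfK// gt_eqF.
rewrite sumr_const card_ord -[_ `^ p *+ N]mulr_natl /test_fun /path_node.
rewrite lev_pt ?path_node_lt// ltnn andbF normr0 mulr0 addr0 /node_mass.
rewrite [leRHS](_ : _ = N%:R / (2 * w N))//.
by field; rewrite !gt_eqF// powR_gt0.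
Qed.

Lemma test_fun_lorentz_ge N r : (0 < N)%N -> (1 <= r)%E ->
  ((N%:R * scale w N / 16)%:E <= lorentz mu p r (maxfun rho mu (test_fun N)))%E.
Proof.
move=> N0 r1; set g := maxfun _ _ _.
(* Half the bound of [test_fun_maxfun], so that all leaves of block N lie strictly above t. Their
   root mass is [scale w N * w N], and the factor 4 of [weak_le_lorentz] turns N / 4 into N / 16. *)
pose t : R := N%:R / (4 * w N).
have t0 : 0 < t by rewrite divr_gt0 ?mulr_gt0 ?ltr0n.
have := weak_le_lorentz mu p1' g t0 r1.
have Dge : ((scale w N * w N)%:E <= distrib_root mu p g t)%E.
  rewrite -(mass_total_root p1 ew) /distrib_root distribE -poweR_EFin.
  rewrite -(mu_level ew (leqnn N)); apply: le_poweR2r => //.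
  apply: mu_le => x /= [bx lx].
  have ix : (idx x < 2 ^ e N)%N by rewrite -lx idx_lt.
  have := test_fun_maxfun ix; rewrite (_ : pt e N N (idx x) = x); last first.
    by rewrite -{1}bx -lx ptK.
  apply: lt_le_trans; rewrite lte_fin ltr_pM2l ?ltr0n//.
  by rewrite ltf_pV2 ?posrE ?mulr_gt0// ltr_pM2r// ltr_nat.
move=> le4; have {le4} : (t%:E * (scale w N * w N)%:E <= 4%:E * lorentz mu p r g)%E.
  by apply: le_trans le4; apply: lee_wpmul2l => //; rewrite lee_fin ltW.
rewrite -EFinM (_ : t * _ = 4 * (N%:R * scale w N / 16)); last first.
  by rewrite /t; field; rewrite gt_eqF.
by rewrite EFinM lee_pmul2l// lte_fin.
Qed.

(** Times [scale w N], it bounds the p-th root of the distribution function of [test_fun N], and its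
    integral over t > 0 is N. *)
Definition level_weight N (t : R) : R := \sum_(k < N) w k * (t < (w k)^-1)%R%:R.

(** For the largest j with t < 1 / w_j, only levels k <= j contribute, and their sum is at most 2
    w_j. *)
Lemma level_weight_le N t :
  level_weight N t = 0 \/
  exists j : 'I_N, t < (w j)^-1 /\ level_weight N t <= 2 * w j.
Proof.
elim: N => [|N IH]; first by left; rewrite /level_weight big_ord0.
have [tN|tN] := ltP t (w N)^-1.
  right; exists ord_max; split => //=; apply: le_trans (sum_level_le p1 ew N).
  apply: ler_sum => k _; rewrite ler_piMr ?(ltW (w0 _))//.
  by case: (t < _).
rewrite /level_weight big_ord_recr /= ltNge tN mulr0 addr0.
case: IH => [|[j [tj le_j]]]; first by left.
by right; exists (widen_ord (leqnSn N) j).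
Qed.

Lemma test_fun_distrib_root N t : 0 <= t ->
  (distrib_root mu p (absE (test_fun N)) t <= (scale w N * level_weight N t)%:E)%E.
Proof.
move=> t0; rewrite /distrib_root distribE.
(* The block is covered by the levels k <= N, but the test function vanishes on the leaves, so [c N]
   is 0. *)
pose c (k : nat) : R := ((k < N)%N && (t < (w k)^-1))%R%:R.
pose A := [set x : node e | (lev x < N)%N /\ t < (w (lev x))^-1].
have le1 : (mu [set x | (t%:E < absE (test_fun N) x)%E] <=
    (\sum_(k < N.+1) mass N k * (2 ^ e k)%:R * c k)%:E)%E.
  apply: (@le_trans _ _ (mu ([set x | block x = N] `&` A))).
    apply: mu_le => x; rewrite /absE /= lte_fin ger0_norm ?test_fun_ge0//.
    rewrite /test_fun; case: ifP => [/andP[/eqP bx lx] tx|_]; first by split.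
    by rewrite ltNge t0.
  apply: le_trans (block_measure_le _ _ _) _; rewrite -sumEFin.
  apply: lee_sum => k _; have kN : (k <= N)%N by rewrite -ltnS.
  rewrite /c; have [h|h] := boolP ((k < N)%N && (t < (w k)^-1)).
    by rewrite mulr1 -(mu_level ew kN); apply: mu_le => x [].
  rewrite mulr0 (_ : _ `&` _ = set0) ?measure0//.
  apply/seteqP; split => x //= [[_ lx] [lxN tx]].
  by move: h; rewrite -lx lxN tx.
apply: le_trans (le_poweR2r ip0 _ le1) _ => //.
rewrite poweR_EFin lee_fin; apply: le_trans (powR_sum_le _ ip01 _) _.
  move=> k; apply: mulr_ge0; last by rewrite /c; case: (_ && _).
  by rewrite mulr_ge0// ltW.
rewrite big_ord_recr /= /c ltnn /= mulr0 powR0 ?addr0; last first.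
  by rewrite gt_eqF//; case/andP: ip01.
rewrite mulr_sumr; apply: ler_sum => k _; rewrite ltn_ord /= mulrA.
case: (t < _); last by rewrite !mulr0 powR0// gt_eqF//; case/andP: ip01.
by rewrite !mulr1 (mass_total_root p1 ew).
Qed.

(** With j from [level_weight_le] and D the root of the distribution function, (t D)^q / t <= (2
    s)^q (t w_j)^q / t <= (2 s)^q w_j, where s = [scale w N], as t w_j <= 1 and q > 1. Since w_j is
    a term of [level_weight N t], the integral is at most (2 s)^q N. *)
Lemma test_fun_lorentz_fin_le N (q : R) : 1 < q ->
  (lorentz mu p q%:E (absE (test_fun N)) <=
   (p * (2 * scale w N) * N%:R `^ q^-1)%:E)%E.
Proof.
move=> q1; have q0 : 0 < q by exact: lt_trans q1.
have c0 : 0 <= 2 * scale w N by rewrite mulr_ge0// ltW.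
have D0 t := distrib_root_ge0 mu p (absE (test_fun N)) t.
rewrite /lorentz -mulrA EFinM; apply: lee_pmul; rewrite ?lee_fin ?powR_ge0 ?poweR_ge0//.
  by rewrite ler1_powR// invf_le1// ltW.
have le1 : (\int[lebesgue_measure]_(t in pos)
    (poweR (t%:E * distrib_root mu p (absE (test_fun N)) t) q * (t^-1)%:E) <=
    ((2 * scale w N) `^ q * N%:R)%:E)%E.
  have -> : N%:R = \sum_(k < N) w k * (w k)^-1.
    rewrite (eq_bigr (fun=> 1)) ?sumr_const ?card_ord// => k _.
    by rewrite divff// gt_eqF.
  rewrite EFinM -(@integral_step _ _ (index_enum 'I_N) (fun k => w k)
    (fun k => (w k)^-1)); last 2 first.
  - by move=> k; exact: ltW.
  - by move=> k; rewrite invr_ge0 ltW.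
  have sum0 t : 0 <= \sum_(k < N) w k * (t < (w k)^-1)%R%:R.
    by apply: sumr_ge0 => k _; rewrite mulr_ge0// ltW.
  rewrite -ge0_integralZl_EFin ?powR_ge0//; last 2 first.
  - by move=> t _; rewrite lee_fin.
  - apply: nonincreasing_emeasurable => // s t st; rewrite lee_fin.
    apply: ler_sum => k _; rewrite ler_pM2l// ler_nat.
    by case: (ltP t) => // tc; rewrite (le_lt_trans st tc).
  apply: ge0_integral_mono => t; rewrite /= in_itv /= andbT => t0.
    by rewrite mule_ge0 ?poweR_ge0// lee_fin invr_ge0 ltW.
  have tD : (t%:E * distrib_root mu p (absE (test_fun N)) t <=
      (t * (scale w N * level_weight N t))%:E)%E.
    by rewrite EFinM lee_wpmul2l ?test_fun_distrib_root// ?lee_fin ltW.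
  apply: (@le_trans _ _ (poweR (t * (scale w N * level_weight N t))%:E q * (t^-1)%:E)%E).
    apply: lee_wpmul2r; first by rewrite lee_fin invr_ge0 ltW.
    by apply: le_poweR2r => //; [exact: ltW|rewrite mule_ge0// lee_fin ltW].
  rewrite poweR_EFin -!EFinM lee_fin.
  have [->|[j [tj lej]]] := level_weight_le N t.
    by rewrite !mulr0 powR0 ?gt_eqF// mul0r mulr_ge0 ?powR_ge0.
  have twj : 0 < t * w j <= 1.
    by rewrite mulr_gt0//= -ler_pdivlMr// div1r ltW.
  apply: (@le_trans _ _ (((2 * scale w N) * (t * w j)) `^ q / t)).
    rewrite ler_pM2r ?invr_gt0//; apply: ge0_ler_powR; rewrite ?nnegrE ?(ltW q0)//.
    + by rewrite mulr_ge0 ?(ltW t0)// mulr_ge0 ?(ltW (s0 _))// sum0.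
    + by rewrite mulr_ge0//; case/andP: twj => /ltW.
    + have := ler_wpM2l (mulr_ge0 (ltW t0) (ltW (s0 N))) lej.
      by congr (_ <= _); ring.
  rewrite powRM//; last by case/andP: twj => /ltW.
  rewrite -mulrA; apply: ler_wpM2l; first exact: powR_ge0.
  apply: (@le_trans _ _ (t * w j / t)).
    by rewrite ler_pM2r ?invr_gt0// ge1r_powR// ltW.
  rewrite mulrAC divff ?gt_eqF// mul1r (bigD1 j)//= tj mulr1 lerDl.
  by apply: sumr_ge0 => k _; rewrite mulr_ge0// ltW.
apply: le_trans (le_poweR2r _ _ le1) _; first by rewrite invr_ge0 ltW.
  apply: integral_ge0 => t; rewrite /= in_itv /= andbT => t0.
  by rewrite mule_ge0 ?poweR_ge0// lee_fin invr_ge0 ltW.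
rewrite poweR_EFin lee_fin powRM ?powR_ge0// -powRrM divff ?gt_eqF// powRr1//.
Qed.

(** Here t D <= 2 s t w_j <= 2 s with s = [scale w N]; the factor N^0 gives the bound the same form
    as for finite q. *)
Lemma test_fun_lorentz_inf_le N :
  (lorentz mu p +oo (absE (test_fun N)) <= (p * (2 * scale w N) * N%:R `^ 0)%:E)%E.
Proof.
rewrite powRr0 mulr1; apply: (@le_trans _ _ (2 * scale w N)%:E); last first.
  by rewrite lee_fin ler_peMl// mulr_ge0// ltW.
apply: ge_ereal_sup => _ [t /= t0 <-].
apply: le_trans (lee_wpmul2l _ (test_fun_distrib_root N (ltW t0))) _.
  by rewrite lee_fin ltW.
rewrite -EFinM lee_fin; have [->|[j [tj lej]]] := level_weight_le N t.
  by rewrite !mulr0 mulr_ge0// ltW.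
have twj : t * w j <= 1 by rewrite -ler_pdivlMr// div1r ltW.
apply: (@le_trans _ _ (t * (scale w N * (2 * w j)))).
  by rewrite !ler_pM2l.
rewrite (_ : t * _ = 2 * scale w N * (t * w j)); last by ring.
by rewrite ler_piMr// mulr_ge0// ltW.
Qed.

Lemma test_fun_lorentz_le (q : \bar R) : (1 < q)%E -> exists theta : R,
  0 <= theta < 1 /\ forall N, (lorentz mu p q (absE (test_fun N)) <=
      (p * (2 * scale w N) * N%:R `^ theta)%:E)%E.
Proof.
case: q => [q||]// q1.
  rewrite lte_fin in q1; exists q^-1; split; last by move=> N; exact: test_fun_lorentz_fin_le.
  by rewrite invr_ge0 ltW ?(lt_trans _ q1)//= invf_lt1// (lt_trans _ q1).
by exists 0; rewrite lexx ltr01; split => // N; exact: test_fun_lorentz_inf_le.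
Qed.

Lemma maxconst_eqy q r : (1 < q)%E -> (1 <= r)%E -> maxconst rho mu p q r = +oo%E.
Proof.
move=> q1 r1; have [theta [/andP[th0 th1] Fle]] := test_fun_lorentz_le q1.
rewrite /maxconst; set S := [set c : R | _].
(* The infimum of the empty set is +oo, so it remains to exclude every finite constant c. *)
suff -> : S = set0 by rewrite image_set0 ereal_inf0.
apply/seteqP; split => // c [c0 Hc].
(* The two estimates for the test function give N s / 16 <= c p (2 s) N^theta with s = [scale w N],
   that is, N^(1 - theta) <= 32 c p, which fails for large N because theta < 1. *)
pose C : R := 32 * c * p.
have C0 : 0 <= C by rewrite !mulr_ge0// ltW.
have bound N : (0 < N)%N -> N%:R `^ (1 - theta) <= C.
  move=> N0; have in_l : in_lorentz mu p q (test_fun N).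
    by split; [move=> _ Y _; exact: measurable_node | exact: le_lt_trans (Fle N) (ltry _)].
  have := le_trans (test_fun_lorentz_ge N0 r1) (Hc _ in_l).
  move=> /le_trans/(_ (lee_wpmul2l _ (Fle N))) => /(_ c0).
  rewrite -EFinM lee_fin => le1.
  have nN : 0 < N%:R :> R by rewrite ltr0n.
  have nt : 0 < N%:R `^ theta :> R by exact: powR_gt0.
  rewrite powRB ?powRr1 ?(ltW nN)//; last by apply/implyP => _; rewrite gt_eqF.
  rewrite ler_pdivrMr// -(ler_pM2r (s0 N)) /C.
  have : N%:R * scale w N / 16 * 16 <= c * (p * (2 * scale w N) * N%:R `^ theta) * 16.
    by rewrite ler_pM2r.
  rewrite divfK//.
  by move=> /le_trans; apply; rewrite le_eqVlt; apply/orP; left; apply/eqP; ring.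
pose N := (Num.trunc ((C + 1) `^ (1 - theta)^-1)).+1.
have CN : (C + 1) `^ (1 - theta)^-1 <= N%:R by rewrite ltW// truncnS_gt.
have := bound N erefl; apply/negP; rewrite -ltNge.
have th : 0 < 1 - theta by rewrite subr_gt0.
apply: (@lt_le_trans _ _ (C + 1)); first by rewrite ltrDl.
have -> : C + 1 = ((C + 1) `^ (1 - theta)^-1) `^ (1 - theta).
  by rewrite -powRrM mulVf ?gt_eqF// powRr1// addr_ge0.
by apply: ge0_ler_powR; rewrite ?nnegrE ?powR_ge0 ?(ltW th).
Qed.

End Lower.

Theorem theorem4p3p1 (R : realType) (p0 : R) (q0 r0 : \bar R) :
  admissible p0 q0 r0 -> (1 < q0)%E ->
  exists (d : measure_display) (T : measurableType d)
         (rho : T -> T -> R) (mu : {measure set T -> \bar R}),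
    metric_measure_space rho mu /\ ~ doubling rho mu /\
    (maxconst rho mu p0 1%E r0 < +oo)%E /\
    maxconst rho mu p0 q0 r0 = +oo%E.
Proof.
move=> [[_ [-> _]]|[p1 [_ [r1 _]]]] q1; first by rewrite ltxx in q1.
have [e [w ew]] := levels_exist p1.
exists _, (node e), (@rho e R), (node_measure e (mass_gt0 ew)); split.
  exact: space_mms.
split; first exact: space_nondoubling.
by split; [exact: maxconst1_lty | exact: maxconst_eqy].
Qed.
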